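(* Let $k,n,m\ge1$ be integers and let $\rho=(k^n)=(k,\ldots,k)$ ($n$ parts). Then $$\sum_{\pi\in\mathrm{PP}(k,n,m)}q^{|\pi|_c}=s_\rho(1^n,q,q^2,\ldots,q^m),$$ $$\sum_{\pi\in\mathrm{PP}'(k,n,m)}q^{|\pi|_c}=s_\rho(1^{n-1},q,q^2,\ldots,q^m),$$ $$\sum_{\pi\in\mathrm{PP}(\infty,n,m)}q^{|\pi|_c}=\prod_{i=1}^{m}(1-q^i)^{-n}.$$
   Context: A plane partition $\pi=(\pi_{ij})_{i,j\ge1}$ is a two-dimensional array of nonnegative integers with finitely many nonzero entries such that $\pi_{ij}\ge\pi_{i+1\,j}$ and $\pi_{ij}\ge\pi_{i\,j+1}$ for all $i,j$ ($i$ is the row index, $j$ the column index). Its shape $\mathrm{sh}(\pi)$ is the partition whose Young diagram is $\{(i,j):\pi_{ij}>0\}$. $\mathrm{PP}(k,n,m)$ is the set of plane partitions with at most $k$ nonzero columns, at most $n$ nonzero rows, and all entries at most $m$; $\mathrm{PP}(\infty,n,m)$ is the same with no restriction on the number of columns. $\mathrm{PP}'(k,n,m)$ is the set of plane partitions whose shape is exactly the rectangle $(k^n)$ ($n$ rows of length $k$, all entries in it positive) and whose entries are at most $m$. With $\mathrm{Des}(\pi)=\{(i,j):\pi_{ij}>\pi_{i+1\,j}\}$, the corner volume is $|\pi|_c=\sum_{(i,j)\in\mathrm{Des}(\pi)}\pi_{ij}$. $s_\rho$ is the Schur polynomial, and $1^r$ denotes $r$ variables set equal to $1$. The third identity is between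 formal power series in $q$. *)

(* Defs.v *)
From HB Require Import structures.
From mathcomp Require Import all_boot all_order all_algebra.
From mathcomp Require Import boolp classical_sets functions cardinality fsbigop.
From mathcomp Require Import mpoly.

Set Implicit Arguments.
Unset Strict Implicit.
Unset Printing Implicit Defensive.

Import GRing.Theory.

Local Open Scope classical_set_scope.
Local Open Scope ring_scope.

(* Arrays are indexed from 0: [pi i j] is the entry usually written
   pi_(i+1, j+1), with [i] the row index and [j] the column index. *)
Definition array := nat -> nat -> nat.

Definition support (pi : array) : set (nat * nat) :=
  [set c | (0 < pi c.1 c.2)%N].

Definition plane_partition : set array :=
  [set pi | [/\ finite_set (support pi),
                forall i j, (pi i.+1 j <= pi i j)%N
              & forall i j, (pi i j.+1 <= pi i j)%N]].

Definition nonzero_rows (pi : array) : set nat :=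
  [set i | exists j, (0 < pi i j)%N].

Definition nonzero_cols (pi : array) : set nat :=
  [set j | exists i, (0 < pi i j)%N].

(* [A #<= `I_k] says that [A] has at most [k] elements. *)
Definition PPinf (n m : nat) : set array :=
  [set pi | [/\ plane_partition pi,
                (nonzero_rows pi #<= `I_n)%card
              & forall i j, (pi i j <= m)%N]].

Definition PP (k n m : nat) : set array :=
  [set pi | PPinf n m pi /\ (nonzero_cols pi #<= `I_k)%card].

(* An integer partition is the sequence of its parts. *)
Definition young_diagram (la : seq nat) : set (nat * nat) :=
  [set c | (c.2 < nth 0 la c.1)%N].

Definition has_shape (pi : array) (la : seq nat) : Prop :=
  support pi = young_diagram la.

Definition PP' (k n m : nat) : set array :=
  [set pi | [/\ plane_partition pi,
                has_shape pi (nseq n k)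
              & forall i j, (pi i j <= m)%N]].

Definition Des (pi : array) : set (nat * nat) :=
  [set c | (pi c.1.+1 c.2 < pi c.1 c.2)%N].

Definition corner_volume (pi : array) : nat :=
  \big[addn/0%N]_(c \in Des pi) pi c.1 c.2.

(* [\big[op/idx]_(x \in A) F x] is [idx] by convention when infinitely many
   terms differ from [idx]; the next lemmas show that this convention is not
   used for the sums over [Des], [PP] and [PP']. *)
Lemma finite_Des pi : plane_partition pi -> finite_set (Des pi).
Proof.
case=> fin_pi _ _; apply: sub_finite_set fin_pi => c; rewrite /Des /support /=.
exact: leq_ltn_trans.
Qed.

Lemma plane_partition_le pi i j i' j' : plane_partition pi ->
  (i' <= i)%N -> (j' <= j)%N -> (pi i j <= pi i' j')%N.
Proof.
case=> _ Hr Hc le_i le_j; apply: (@leq_trans (pi i' j)).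
  elim: i le_i => [|i IHi]; first by rewrite leqn0 => /eqP->.
  rewrite leq_eqVlt => /orP[/eqP-> // | /IHi]; exact: leq_trans (Hr _ _).
elim: j le_j => [|j IHj]; first by rewrite leqn0 => /eqP->.
rewrite leq_eqVlt => /orP[/eqP-> // | /IHj]; exact: leq_trans (Hc _ _).
Qed.

Lemma PPinf_row0 n m pi i j : PPinf n m pi -> (n <= i)%N -> pi i j = 0%N.
Proof.
case=> pp_pi rows_pi _ le_n_i; apply/eqP; rewrite -leqn0 leqNgt.
apply/negP => pi_gt0; have: (`I_i.+1 #<= `I_n)%card.
  apply: card_le_trans rows_pi; apply: subset_card_le => a; rewrite /= ltnS.
  by move=> le_a; exists j; apply: leq_trans pi_gt0 (plane_partition_le _ _ _).
by rewrite card_le_II ltnNge le_n_i.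
Qed.

Lemma PP_col0 k n m pi i j : PP k n m pi -> (k <= j)%N -> pi i j = 0%N.
Proof.
case=> -[pp_pi _ _] cols_pi le_k_j; apply/eqP; rewrite -leqn0 leqNgt.
apply/negP => pi_gt0; have: (`I_j.+1 #<= `I_k)%card.
  apply: card_le_trans cols_pi; apply: subset_card_le => a; rewrite /= ltnS.
  by move=> le_a; exists i; apply: leq_trans pi_gt0 (plane_partition_le _ _ _).
by rewrite card_le_II ltnNge le_k_j.
Qed.

Lemma finite_bounded_arrays k n m :
  finite_set [set pi : array | [/\ forall i j, (n <= i)%N -> pi i j = 0%N,
    forall i j, (k <= j)%N -> pi i j = 0%N & forall i j, (pi i j <= m)%N]].
Proof.
pose ext (f : {ffun 'I_n.+1 * 'I_k.+1 -> 'I_m.+1}) : array := fun i j =>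
  if (i < n)%N && (j < k)%N then f (inord i, inord j) : nat else 0%N.
apply: (@sub_finite_set _ _ (ext @` setT)); last first.
  exact: finite_image (@finite_finset _ _).
move=> pi [row0 col0 le_m]; exists [ffun c : 'I_n.+1 * 'I_k.+1 => inord (pi c.1 c.2)] => //.
apply/funext => i; apply/funext => j; rewrite /ext.
have [lt_i | le_i] /= := ltnP i n; last by rewrite row0.
have [lt_j | le_j] /= := ltnP j k; last by rewrite col0.
by rewrite ffunE /= !inordK // ltnS // ltnW.
Qed.

Lemma finite_PP k n m : finite_set (PP k n m).
Proof.
apply: sub_finite_set (finite_bounded_arrays k n m) => pi PPpi; split.
- by move=> i j; apply: PPinf_row0; case: PPpi => [+ _]; apply.
- by move=> i j; apply: PP_col0; exact: PPpi.
- by case: PPpi => -[].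
Qed.

Lemma finite_PP' k n m : finite_set (PP' k n m).
Proof.
apply: sub_finite_set (finite_bounded_arrays k n m) => pi [_ sh_pi le_m].
have supp i j : (0 < pi i j)%N = (i < n)%N && (j < k)%N.
  apply/idP/idP => [pi_gt0 | /andP[lt_i lt_j]].
    have: young_diagram (nseq n k) (i, j) by rewrite -sh_pi.
    by rewrite /young_diagram /= nth_nseq; case: ifP.
  have: support pi (i, j) by rewrite sh_pi /young_diagram /= nth_nseq lt_i.
  by [].
by split=> // i j le_ij; apply/eqP; rewrite -leqn0 leqNgt supp negb_and
  -!leqNgt le_ij ?orbT.
Qed.

(* The boxes of the Young diagram of [la]: the box [Tagged _ j] with tag [i]
   lies in row [i] and column [j]. *)
Definition box (la : seq nat) := {i : 'I_(size la) & 'I_(nth 0%N la i)}.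

Definition box_row la (b : box la) : nat := tag b.
Definition box_col la (b : box la) : nat := tagged b.

Definition semistandard N la (T : {ffun box la -> 'I_N}) : bool :=
  [forall b, forall c,
    ((box_row b == box_row c) && (box_col b < box_col c)%N ==> (T b <= T c)%N)
    && ((box_col b == box_col c) && (box_row b < box_row c)%N
        ==> (T b < T c)%N)].

Definition schur (R : comNzRingType) (N : nat) (la : seq nat) : {mpoly R[N]} :=
  \sum_(T : {ffun box la -> 'I_N} | semistandard T) \prod_(b : box la) 'X_(T b).

(* The point (1^r, q, q^2, ..., q^m), where q is the variable of {poly int}. *)
Definition ones_qpowers (r m : nat) (i : 'I_(r + m)) : {poly int} :=
  match fintype.split i with
  | inl _ => 1
  | inr j => 'X^(j.+1)
  end.

Record fps (R : Type) := Fps { fcoef : nat -> R }.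

Lemma fps_ext (R : Type) (f g : fps R) : fcoef f =1 fcoef g -> f = g.
Proof. by case: f g => [f] [g] /= /funext->. Qed.

HB.instance Definition _ (R : Type) := gen_eqMixin (fps R).
HB.instance Definition _ (R : Type) := gen_choiceMixin (fps R).

Section FpsRing.
Variable R : comNzRingType.
Implicit Types f g h : fps R.

Definition fps_zero : fps R := Fps (fun _ => 0).
Definition fps_opp f : fps R := Fps (fun d => - fcoef f d).
Definition fps_add f g : fps R := Fps (fun d => fcoef f d + fcoef g d).
Definition fps_one : fps R := Fps (fun d => (d == 0%N)%:R).
Definition fps_mul f g : fps R :=
  Fps (fun d => \sum_(i < d.+1) fcoef f i * fcoef g (d - i)%N).

Fact fps_addA : associative fps_add.
Proof. by move=> f g h; apply: fps_ext => d; apply: addrA. Qed.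
Fact fps_addC : commutative fps_add.
Proof. by move=> f g; apply: fps_ext => d; apply: addrC. Qed.
Fact fps_add0 : left_id fps_zero fps_add.
Proof. by move=> f; apply: fps_ext => d; apply: add0r. Qed.
Fact fps_addN : left_inverse fps_zero fps_opp fps_add.
Proof. by move=> f; apply: fps_ext => d; apply: addNr. Qed.

HB.instance Definition _ :=
  GRing.isZmodule.Build (fps R) fps_addA fps_addC fps_add0 fps_addN.

Definition fps_trunc (N : nat) f : {poly R} := \poly_(i < N) fcoef f i.

Fact coef_fps_mul N f g d : (d < N)%N ->
  fcoef (fps_mul f g) d = (fps_trunc N f * fps_trunc N g)`_d.
Proof.
move=> lt_d; rewrite coefM; apply: eq_bigr => i _; rewrite !coef_poly.
by rewrite !(leq_ltn_trans _ lt_d) ?leq_subr // -ltnS.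
Qed.

Fact fps_mulC : commutative fps_mul.
Proof.
move=> f g; apply: fps_ext => d.
by rewrite !(@coef_fps_mul d.+1) // mulrC.
Qed.

Fact fps_mulA : associative fps_mul.
Proof.
move=> f g h; apply: fps_ext => d; have lt_d := ltnSn d.
have -> : fcoef (fps_mul f (fps_mul g h)) d =
    (fps_trunc d.+1 f * (fps_trunc d.+1 g * fps_trunc d.+1 h))`_d.
  rewrite coefM; apply: eq_bigr => i _.
  by rewrite coef_poly ltn_ord (@coef_fps_mul d.+1) // ltnS leq_subr.
rewrite mulrA coefM; apply: eq_bigr => i _.
by rewrite (@coef_fps_mul d.+1) // coef_poly ltnS leq_subr.
Qed.

Fact fps_mul1 : left_id fps_one fps_mul.
Proof.
move=> f; apply: fps_ext => d; rewrite /= big_ord_recl subn0 mul1r.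
by rewrite big1 ?addr0 // => i _; rewrite mul0r.
Qed.

Fact fps_mulDl : left_distributive fps_mul fps_add.
Proof.
move=> f g h; apply: fps_ext => d; rewrite /= -big_split.
by apply: eq_bigr => i _; rewrite mulrDl.
Qed.

Fact fps_one_neq0 : fps_one != 0 :> fps R.
Proof.
by apply/eqP => /(congr1 (fun f => fcoef f 0)) /= /eqP; rewrite oner_eq0.
Qed.

HB.instance Definition _ := GRing.Zmodule_isComNzRing.Build (fps R)
  fps_mulA fps_mulC fps_mul1 fps_mulDl fps_one_neq0.

Definition fps_const (c : R) : fps R := Fps (fun d => c *+ (d == 0%N)).

Definition fpsX : fps R := Fps (fun d => (d == 1%N)%:R).

Lemma fcoefD f g d : fcoef (f + g) d = fcoef f d + fcoef g d.
Proof. by []. Qed.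

Lemma fcoefN f d : fcoef (- f) d = - fcoef f d.
Proof. by []. Qed.

Lemma fcoef1 d : fcoef (1 : fps R) d = (d == 0%N)%:R.
Proof. by []. Qed.

Lemma fcoefM f g d :
  fcoef (f * g) d = \sum_(i < d.+1) fcoef f i * fcoef g (d - i)%N.
Proof. by []. Qed.

Lemma fcoef_sum (I : Type) (r : seq I) (F : I -> fps R) d :
  fcoef (\sum_(i <- r) F i) d = \sum_(i <- r) fcoef (F i) d.
Proof. exact: (big_morph (fun f => fcoef f d)). Qed.

Lemma fcoefXn i d : fcoef (fpsX ^+ i) d = (d == i)%:R.
Proof.
elim: i d => [|i IHi] d; first by [].
rewrite exprS fcoefM; case: d => [|d].
  by rewrite big_ord1 mul0r.
rewrite 2!big_ord_recl big1 => [|j _]; last by rewrite mul0r.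
by rewrite mul0r add0r addr0 mul1r IHi subSS subn0 eqSS.
Qed.

Lemma fcoef_expr_small f i d :
  fcoef f 0 = 0 -> (d < i)%N -> fcoef (f ^+ i) d = 0.
Proof.
move=> f0; elim: i d => // i IHi d; rewrite ltnS exprS fcoefM => le_d_i.
apply: big1 => -[[|j] /= lt_j] _; first by rewrite f0 mul0r.
rewrite IHi ?mulr0 //; apply: leq_trans le_d_i; rewrite ltn_subrL /=.
by rewrite ltnS in lt_j; apply: leq_ltn_trans lt_j.
Qed.

End FpsRing.

Section FpsUnitRing.
Variable R : comUnitRingType.
Implicit Types f g : fps R.

Definition fps_unit : {pred fps R} := [pred f | fcoef f 0 \is a GRing.unit].

(* With c the constant term of f and u = 1 - f / c, so that u has zero constant
   term, 1 / f = c^-1 (1 + u + u^2 + ...), and only the powers u^j with j <= d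
   contribute to the coefficient of degree d. *)
Definition fps_inv f : fps R :=
  if f \in fps_unit then
    let ci := fps_const (fcoef f 0)^-1 in
    Fps (fun d => fcoef (ci * \sum_(j < d.+1) (1 - ci * f) ^+ j) d)
  else f.

Fact fps_mulV : {in fps_unit, left_inverse 1 fps_inv *%R}.
Proof.
move=> f uf; rewrite /fps_inv uf.
set ci := fps_const _; set u := 1 - ci * f.
have u0 : fcoef u 0 = 0.
  by rewrite fcoefD fcoefN fcoefM big_ord1 /= mulVr ?subrr.
apply: fps_ext => d.
have -> : fcoef (1 : fps R) d = fcoef (ci * (\sum_(j < d.+1) u ^+ j) * f) d.
  rewrite mulrAC -[ci * f](subKr 1) -/u -opprB mulNr -subrX1 opprB fcoefD fcoefN.
  by rewrite [fcoef (u ^+ _) d]fcoef_expr_small // subr0.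
rewrite [LHS]fcoefM [RHS]fcoefM; apply: eq_bigr => -[i /=]; rewrite ltnS => le_i _.
congr (_ * _); rewrite -[LHS]/(fcoef (ci * \sum_(j < i.+1) u ^+ j) i) !fcoefM; apply: eq_bigr => a _; congr (_ * _).
rewrite !fcoef_sum -(subnKC le_i) -addSn big_split_ord /= [X in _ = _ + X]big1 ?addr0 //.
move=> j _; apply: fcoef_expr_small => //.
by rewrite addSn ltnS; apply: leq_trans (leq_subr _ _) (leq_addr _ _).
Qed.

Fact fps_unitPl f g : g * f = 1 -> fps_unit f.
Proof.
move=> /(congr1 (fun h => fcoef h 0)); rewrite fcoefM big_ord1 /= subn0 => gf1.
by apply/unitrPr; exists (fcoef g 0); rewrite mulrC.
Qed.

Fact fps_inv_out : {in [predC fps_unit], fps_inv =1 id}.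
Proof. by move=> f; rewrite inE /fps_inv => /negPf->. Qed.

HB.instance Definition _ := GRing.ComNzRing_hasMulInverse.Build (fps R)
  fps_mulV fps_unitPl fps_inv_out.

Lemma fps_unitE f : (f \is a GRing.unit) = (fcoef f 0 \is a GRing.unit).
Proof. by []. Qed.

End FpsUnitRing.

(* The family of formal power series F x, for x in A, is summable with sum S:
   each degree receives finitely many nonzero contributions, which add up to
   the coefficient of S. *)
Definition fps_has_sum (R : comNzRingType) (I : choiceType) (A : set I)
    (F : I -> fps R) (S : fps R) : Prop :=
  forall d : nat,
    finite_set [set x | A x /\ fcoef (F x) d <> 0] /\
    \sum_(x \in A) fcoef (F x) d = fcoef S d.

(* Main.v *)
Require Import Defs.
From mathcomp Require Import all_boot all_order all_algebra.
From mathcomp Require Import boolp classical_sets functions cardinality fsbigop.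
From mathcomp Require Import mpoly zify.

(* A plane partition is the chain of its level sets {pi >= l}, and its corner
   volume is the sum over l of l times the number of nonempty columns of the
   l-th skew shape in the chain.  So the generating function of the plane
   partitions of shape la is an entry of a product C(q) C(q^2) ... C(q^m) of
   operators on functions of partitions with n rows, where C(y) sums over the
   subpartitions mu of la with weight y^(nonempty columns of la/mu).  The same
   decomposition of reverse tableaux expresses Schur polynomials through
   operators U(y), which sum over the mu such that la/mu is a horizontal strip.
   If E sums over the elegant fillings of la/mu (entries in row i less than i),
   then C(y) E = E U(y); for a one-column step this is a row by row toggling.
   On the empty partition E is trivial, and on a rectangle with n rows E is
   U(1)^(n-1), which accounts for the n - 1 variables equal to 1.  The sum over
   PP(k,n,m) is the same product with an additional first factor C(1).

   For the last identity, sum first over the largest shape of the chain: given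
   the next one, the rows of la are la_i = max(mu_i, la_(i+1)) + d_i with free
   d_i >= 0, so each level l contributes (1 - q^l)^(-n). *)

Set Implicit Arguments.
Unset Strict Implicit.
Unset Printing Implicit Defensive.

Import GRing.Theory.

Local Open Scope ring_scope.

(** * Shapes and the commutation C(y) E = E U(y) *)

Section Words.
Variable T : Type.
Implicit Types (s : seq T) (n : nat).

Definition words s n : seq (seq T) :=
  iter n (fun W => [seq x :: w | x <- s, w <- W]) [:: [::]].

Lemma big_words0 (R : nmodType) s (P : pred (seq T)) (F : seq T -> R) :
  \sum_(w <- words s 0 | P w) F w = if P [::] then F [::] else 0.
Proof. by rewrite big_mkcond big_seq1. Qed.

Lemma big_wordsS (R : nmodType) s n (P : pred (seq T)) (F : seq T -> R) :
  \sum_(w <- words s n.+1 | P w) F w =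
  \sum_(x <- s) \sum_(w <- words s n | P (x :: w)) F (x :: w).
Proof.
rewrite big_mkcond big_allpairs_dep; apply: eq_bigr => x _.
by rewrite [RHS]big_mkcond.
Qed.

End Words.

Lemma mem_words (T : eqType) (s : seq T) n w :
  (w \in words s n) = (size w == n) && all (mem s) w.
Proof.
elim: n w => [|n IHn] [|x w] //=; first by apply/allpairsP => -[[y v]] [].
apply/allpairsP/idP => [[[y v] /= [ys vs [-> ->]]]|].
  by rewrite ys -[n in _ == n.+1]/n eqSS /= -IHn.
rewrite eqSS => /and3P[sw xs allw]; exists (x, w); split=> //=.
by rewrite IHn sw.
Qed.

Lemma words_uniq (T : eqType) (s : seq T) n : uniq s -> uniq (words s n).
Proof.
move=> us; elim: n => //= n IHn; apply: allpairs_uniq => //.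
by move=> [x v] [y w] _ _ /= [-> ->].
Qed.

Implicit Types (la mu ka : seq nat).

(** Missing parts count as 0, so that sequences of different lengths can be compared, such as
    [behead la] and [mu] in [hstrip]. *)
Fixpoint leqs la mu : bool :=
  match la, mu with
  | l :: la', u :: mu' => (l <= u)%N && leqs la' mu'
  | l :: la', [::] => (l == 0)%N && leqs la' [::]
  | [::], _ => true
  end.

Lemma leqs_nth la mu :
  reflect (forall i, nth 0%N la i <= nth 0%N mu i)%N (leqs la mu).
Proof.
elim: la mu => [|l la IH] [|u mu] /=.
- by apply: ReflectT => i; rewrite nth_nil.
- by apply: ReflectT => i; rewrite nth_nil.
- apply: (iffP andP) => [[/eqP-> /IH lela] [|i] //=|lela].
    by move: (lela i); rewrite nth_nil.
  split; first by rewrite -leqn0; exact: (lela 0%N).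
  by apply/IH => i; have := lela i.+1; rewrite /= nth_nil.
- apply: (iffP andP) => [[lu /IH lela] [|i] //=|lela].
  by split; [exact: (lela 0%N) | apply/IH => i; exact: (lela i.+1)].
Qed.

Lemma leqs_refl : reflexive leqs.
Proof. by move=> la; apply/leqs_nth. Qed.

Lemma leqs_head la mu : leqs la mu -> (head 0 la <= head 0 mu)%N.
Proof. by move=> /leqs_nth /(_ 0%N); rewrite !nth0. Qed.

Definition part la := sorted geq la.

Lemma part_cons l la : part (l :: la) = (head 0 la <= l)%N && part la.
Proof. by case: la. Qed.

(** The larger shape comes first; only the smaller one is required to be a partition. *)
Definition subpart la mu := part mu && leqs mu la.
(** This is the interlacing condition [la_(i+1) <= mu_i <= la_i]: no column of [la/mu] contains two
    boxes. *)
Definition hstrip la mu := subpart la mu && leqs (behead la) mu.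

Arguments part : simpl never.
Arguments subpart : simpl never.
Arguments hstrip : simpl never.

Lemma leqs_behead la u mu :
  leqs la (u :: mu) = (head 0 la <= u)%N && leqs (behead la) mu.
Proof. by case: la. Qed.

Lemma subpart_cons l la u mu : subpart (l :: la) (u :: mu) =
  [&& (u <= l)%N, (head 0 mu <= u)%N & subpart la mu].
Proof. by rewrite /subpart part_cons /= -!andbA; do !bool_congr. Qed.

Lemma hstrip_cons l la u mu : hstrip (l :: la) (u :: mu) =
  (head 0 la <= u <= l)%N && hstrip la mu.
Proof.
rewrite /hstrip subpart_cons /= leqs_behead.
apply/idP/idP => [/andP[/and3P[-> _ ->] /andP[-> ->]] //|].
move=> /andP[/andP[lau ->] /andP[subm ->]]; rewrite lau subm !andbT /=.
by apply: leq_trans lau; apply: leqs_head; case/andP: subm.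
Qed.

(* The number of nonempty columns of the skew shape [la/mu]: row [i] accounts
   for the columns [j] with [mu_i <= j < la_i] and [la_(i+1) <= j]. *)
Fixpoint ncols la mu : nat :=
  match la, mu with
  | l :: la', u :: mu' => (l - maxn u (head 0 la') + ncols la' mu')%N
  | _, _ => 0%N
  end.

(* The sum of [min (mu_(i-1), la_i) - mu_i], with [mu_0 = a]; [ncols_belowE]
   recovers [ncols] from it by [min + max = sum]. *)
Fixpoint ncols_below a la mu : nat :=
  match la, mu with
  | l :: la', u :: mu' => (minn a l - u + ncols_below u la' mu')%N
  | _, _ => 0%N
  end.

Lemma ncols_belowE a la mu : size la = size mu -> part la ->
  subpart la mu -> (head 0 mu <= a)%N ->
  ncols la mu = (ncols_below a la mu + (head 0 la - minn a (head 0 la)))%N.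
Proof.
elim: la mu a => [|l la IH] [|u mu] //= a.
move=> [eq_size]; rewrite part_cons subpart_cons => /andP[hl pla].
move=> /and3P[ul hu sub] ua; rewrite (IH _ u) //.
have : (head 0 la - minn u (head 0 la) + (l - maxn u (head 0 la)) = l - u)%N.
  by lia.
by move: (ncols_below _ _ _) => c; lia.
Qed.

Arguments words : simpl never.

(** These are all sequences in the box, not only partitions; the predicates of the sums impose the
    rest. Sums thus split off the first row freely. *)
Definition shapes K n := words (index_iota 0 K) n.

Arguments shapes : simpl never.

Lemma mem_shapes K n la :
  (la \in shapes K n) = (size la == n) && all (ltn^~ K) la.
Proof.
rewrite mem_words; congr (_ && _); apply: eq_all => x /=.
by rewrite mem_index_iota.
Qed.

Lemma shapes_consP K n x la : x :: la \in shapes K n.+1 =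
  (x < K)%N && (la \in shapes K n).
Proof. by rewrite !mem_shapes /= eqSS; do !bool_congr. Qed.

Lemma big_shapesS (R : nmodType) K n (P : pred (seq nat)) (F : seq nat -> R) :
  \sum_(w <- shapes K n.+1 | P w) F w =
  \sum_(0 <= x < K) \sum_(w <- shapes K n | P (x :: w)) F (x :: w).
Proof. exact: big_wordsS. Qed.

Lemma big_shapes0 (R : nmodType) K (P : pred (seq nat)) (F : seq nat -> R) :
  \sum_(w <- shapes K 0 | P w) F w = if P [::] then F [::] else 0.
Proof. exact: big_words0. Qed.

Section Commutation.
Variables (R : comNzRingType) (K : nat).
Implicit Types (x y : R) (f g : seq nat -> R).

(** Reflect the interval by [u -> b + M - u]; as [M < K], the whole interval is summed. *)
Lemma geom_rev y b M : (M < K)%N ->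
  \sum_(0 <= u < K | (b <= u <= M)%N) y ^+ (M - u) =
  \sum_(0 <= u < K | (b <= u <= M)%N) y ^+ (u - b).
Proof.
move=> ltMK; have widen (F : nat -> R) :
    \sum_(0 <= u < K | (b <= u <= M)%N) F u = \sum_(b <= u < M.+1) F u.
  rewrite [RHS](big_nat_widen _ _ K) // [RHS](big_nat_widenl _ 0%N) //=.
  by apply: eq_bigl => u; rewrite ltnS andbC.
rewrite !widen big_nat_rev; apply: eq_big_nat => u bu; congr (_ ^+ _); lia.
Qed.

(* One column of the toggling argument: replacing [mu_i] by
   [min (mu_(i-1), la_i) + max (mu_(i+1), ka_i) - mu_i], from the last row to
   the first, exchanges the two weights. *)
Lemma toggle y a la ka n : size la = n -> size ka = n ->
    all (ltn^~ K) la ->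
  \sum_(mu <- shapes K n | [&& head 0 mu <= a, subpart la mu & leqs ka mu]%N)
     y ^+ ncols_below a la mu =
  \sum_(mu <- shapes K n | [&& head 0 mu <= a, subpart la mu & leqs ka mu]%N)
     y ^+ ncols mu ka.
Proof.
elim: n a la ka => [|n IHn] a [|l la] [|k ka] //=; first by rewrite !big_shapes0.
move=> [sla] [ska] /andP[lK laK]; rewrite !big_shapesS /=.
pose P u mu := [&& (u <= minn a l)%N, (k <= u)%N, (head 0 mu <= u)%N,
  subpart la mu & leqs ka mu].
have PE u mu : [&& u <= a, subpart (l :: la) (u :: mu),
  k <= u & leqs ka mu]%N = P u mu.
  by rewrite subpart_cons /P leq_min -!andbA; do !bool_congr.
(* The rows below are toggled first, with [u] as their new bound from above. *)
transitivity (\sum_(0 <= u < K) \sum_(mu <- shapes K n | P u mu)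
    y ^+ (minn a l - u) * y ^+ ncols mu ka).
  apply: eq_bigr => u _; under eq_bigl do rewrite PE.
  under eq_bigr do rewrite exprD; rewrite -!big_distrr /=.
  have [C|C] := boolP ((u <= minn a l)%N && (k <= u)%N); last first.
    rewrite [X in _ * X]big_pred0 ?[X in _ = _ * X]big_pred0 // => mu;
      by rewrite /P andbA (negPf C).
  rewrite /P; under eq_bigl do rewrite andbA C; rewrite IHn //.
  by under [in RHS]eq_bigl do rewrite andbA C.
under [RHS]eq_bigr do under eq_bigl do rewrite PE.
(* For fixed lower rows, the first row runs over an interval, on which [geom_rev] exchanges the two
   weights. *)
have exch (F : nat -> seq nat -> R) :
   \sum_(0 <= u < K) \sum_(mu <- shapes K n | P u mu) F u mu =
   \sum_(mu <- shapes K n | subpart la mu && leqs ka mu)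
     \sum_(0 <= u < K | (maxn k (head 0 mu) <= u <= minn a l)%N) F u mu.
  rewrite (exchange_big_dep (fun mu => subpart la mu && leqs ka mu)) /=.
    apply: eq_bigr => mu C; apply: eq_bigl => u; rewrite /P C andbT geq_max.
    by rewrite -[RHS]andbA andbC -!andbA; do !bool_congr.
  by move=> u mu _ /and5P[_ _ _ -> ->].
rewrite !exch; apply: eq_bigr => mu _.
under eq_bigr do rewrite mulrC; under [RHS]eq_bigr do rewrite addnC exprD.
rewrite -!big_distrr /= geom_rev ?gtn_min ?lK ?orbT //.
Qed.

(** With [subpart] this is C(y), and with [hstrip] it is U(y): in a horizontal strip each nonempty
    column is a single box. *)
Definition stepop n (r : rel (seq nat)) y f la : R :=
  \sum_(mu <- shapes K n | r la mu) y ^+ ncols la mu * f mu.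

Lemma eq_stepop n (r : rel (seq nat)) y f g la :
  {in shapes K n, forall mu, r la mu -> f mu = g mu} ->
  stepop n r y f la = stepop n r y g la.
Proof.
move=> eqfg; rewrite /stepop big_seq_cond [RHS]big_seq_cond.
by apply: eq_bigr => mu /andP[muK rmu]; rewrite eqfg.
Qed.

(** After exchanging the sums, the coefficients of [g ka] on the two sides are the two sums of
    [toggle]. *)
Lemma stepop_toggle y a la n g : la \in shapes K n ->
  \sum_(mu <- shapes K n | (head 0 mu <= a)%N && subpart la mu)
     y ^+ ncols_below a la mu * stepop n subpart 1 g mu =
  \sum_(mu <- shapes K n | (head 0 mu <= a)%N && subpart la mu)
     stepop n subpart y g mu.
Proof.
rewrite mem_shapes => /andP[/eqP sla laK]; rewrite /stepop.
under eq_bigr do rewrite big_distrr /=.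
rewrite (exchange_big_dep part) /=; last by move=> mu ka _ /andP[].
rewrite [RHS](exchange_big_dep part) /=; last by move=> mu ka _ /andP[].
rewrite big_seq_cond [RHS]big_seq_cond; apply: eq_bigr => ka /andP[kaK pka].
under eq_bigr do rewrite expr1n mul1r.
rewrite -!big_distrl /=; congr (_ * _).
have E mu : ((head 0 mu <= a) && subpart la mu && subpart mu ka)%N =
   [&& head 0 mu <= a, subpart la mu & leqs ka mu]%N.
  by rewrite -andbA [subpart mu ka]/subpart pka.
rewrite (eq_bigl _ _ E) [RHS](eq_bigl _ _ E); apply: toggle => //.
by move: kaK; rewrite mem_shapes => /andP[/eqP].
Qed.

(* [elegop] sums over the elegant fillings of [la/mu], i.e., the semistandard
   fillings by 1, 2, ... whose entries in row [i] are less than [i]. *)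
Fixpoint elegop n f la : R :=
  match n, la with
  | n'.+1, l :: la' => \sum_(mu <- shapes K n' | subpart la' mu)
                         elegop n' (fun r => f (l :: r)) mu
  | _, _ => f la
  end.

Lemma eq_elegop n f g : f =1 g -> elegop n f =1 elegop n g.
Proof.
elim: n f g => [|n IHn] f g eqfg [|l la] //=.
by apply: eq_bigr => mu _; apply: IHn => r.
Qed.

Lemma elegop0 n la : elegop n (fun=> 0) la = 0.
Proof. by elim: n la => [|n IHn] [|l la] //=; apply: big1 => mu _; apply: IHn. Qed.

Lemma elegop_sum n (I : Type) (s : seq I) (c : I -> R) (F : I -> seq nat -> R) la :
  elegop n (fun r => \sum_(i <- s) c i * F i r) la =
  \sum_(i <- s) c i * elegop n (F i) la.
Proof.
elim: n F la => [|n IHn] F [|l la] //=.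
under eq_bigr do rewrite IHn; rewrite exchange_big /=.
by apply: eq_bigr => i _; rewrite big_distrr.
Qed.

(** E never changes the first row, so a condition on it passes through. *)
Lemma elegop_head n (p : pred nat) f la :
  elegop n (fun r => if p (head 0%N r) then f r else 0) la =
  if p (head 0%N la) then elegop n f la else 0.
Proof.
case: n la => [|n] [|l la] //=.
case: ifP => // _; apply: big1 => mu _.
exact: elegop0.
Qed.

(** The strip condition gives [head 0 la <= u], so the first row accounts for [l - u] columns. The
    conditions on [l] and on [la] are kept in separate factors, so that [elegop_sum] can extract the
    first and [elegop_head] the second. *)
Lemma hstripop_cons n y f l la : stepop n.+1 hstrip y f (l :: la) =
  \sum_(0 <= u < K) (if (u <= l)%N then y ^+ (l - u) else 0) *
    (if (head 0 la <= u)%N then stepop n hstrip y (fun mu => f (u :: mu)) la else 0).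
Proof.
rewrite /stepop big_shapesS; apply: eq_bigr => u _.
under eq_bigl do rewrite hstrip_cons.
case: (leqP (head 0%N la) u) => hu; last by rewrite mulr0 big_pred0.
case: (leqP u l) => ul /=; last by rewrite mul0r big_pred0.
rewrite big_distrr /=; apply: eq_bigr => mu _.
by rewrite (maxn_idPl hu) exprD mulrA.
Qed.

(** Induction on the number of rows. Once the new first row [u] is fixed, E on the remaining rows
    starts with a step of weight 1; toggling moves [y] onto this step, where the induction
    hypothesis applies. In the recursion for E, boxes removed from row i by the s-th nested sum
    carry the entry i - s. *)
Lemma stepop_elegop n y f la : la \in shapes K n -> part la ->
  stepop n subpart y (elegop n f) la = elegop n (stepop n hstrip y f) la.
Proof.
elim: n f la => [|n IHn] f [|l la] //=; rewrite ?mem_shapes //.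
  by move=> _ _; rewrite /stepop !big_shapes0.
rewrite -mem_shapes shapes_consP part_cons => /andP[lK laK] /andP[hla pla].
under [RHS]eq_bigr => mu _ do
  rewrite (eq_elegop _ (fun r => hstripop_cons n y f l r)) elegop_sum.
rewrite exchange_big /stepop big_shapesS /=; apply: eq_bigr => u _.
case: (leqP u l) => ul; last first.
  rewrite big_pred0 ?big1 // => [mu _|mu]; first by rewrite mul0r.
  by rewrite subpart_cons leqNgt ul.
have E mu : subpart (l :: la) (u :: mu) = (head 0%N mu <= u)%N && subpart la mu.
  by rewrite subpart_cons ul.
rewrite (eq_bigl _ _ E).
transitivity (\sum_(mu <- shapes K n | (head 0%N mu <= u)%N && subpart la mu)
   y ^+ (l - u) * (y ^+ ncols_below u la mu *
     stepop n subpart 1 (elegop n (fun r => f (u :: r))) mu)).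
  rewrite big_seq_cond [RHS]big_seq_cond; apply: eq_bigr => mu /and3P[muK hmu sub].
  rewrite mulrA -exprD; congr (_ ^+ _ * _).
    (* With the bound equal to the first part [l], the correction term of [ncols_belowE]
       vanishes. *)
    have := @ncols_belowE l (l :: la) (u :: mu).
    rewrite /= part_cons hla pla E hmu sub minnn subnn => -> //; first lia.
    by move: laK muK; rewrite !mem_shapes => /andP[/eqP-> _] /andP[/eqP-> _].
  by rewrite /stepop; apply: eq_bigr => ka _; rewrite expr1n mul1r.
rewrite -big_distrr /= stepop_toggle // big_distrr /= big_mkcondl /=.
rewrite big_seq_cond [RHS]big_seq_cond; apply: eq_bigr => mu /andP[muK sub].
rewrite (elegop_head n (leq^~ u) (stepop n hstrip y (fun mu => f (u :: mu)))).
case: ifP => _; last by rewrite mulr0.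
by rewrite IHn //; case/andP: sub.
Qed.

End Commutation.

(** * Rectangular shapes *)

Lemma part_nth la i : part la -> (nth 0 la i.+1 <= nth 0 la i)%N.
Proof.
elim: la i => [|l la IH] i; first by rewrite !nth_nil.
by rewrite part_cons -nth0 => /andP[hl /IH pla]; case: i.
Qed.

Lemma part_nthP la : (forall i, nth 0 la i.+1 <= nth 0 la i)%N -> part la.
Proof.
elim: la => // l la IH dec; rewrite part_cons -nth0 (dec 0%N).
by apply: IH => i; apply: (dec i.+1).
Qed.

Lemma part_nseq n k : part (nseq n k).
Proof. by apply: part_nthP => i; rewrite !nth_nseq; case: ltnP => // /ltnW->. Qed.

Lemma leqs_nseq0 n la : leqs (nseq n 0%N) la.
Proof. by apply/leqs_nth => i; rewrite nth_nseq if_same. Qed.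

Lemma subpart_nseq0 n la : subpart la (nseq n 0%N).
Proof. by rewrite /subpart part_nseq leqs_nseq0. Qed.

Lemma nseq_shapes K n k : (k < K)%N -> nseq n k \in shapes K n.
Proof. by move=> kK; rewrite mem_shapes size_nseq eqxx all_nseq /= kK orbT. Qed.

Section Rectangle.
Variables (R : comNzRingType) (k : nat).
Implicit Types (x : R) (f : seq nat -> R).

Lemma sum_shapes_delta n (P : pred (seq nat)) (F : seq nat -> R) :
  P (nseq n 0%N) ->
  \sum_(mu <- shapes k.+1 n | P mu) F mu * (mu == nseq n 0%N)%:R =
  F (nseq n 0%N).
Proof.
move=> Pz; rewrite big_mkcond (bigD1_seq (nseq n 0%N)) /=.
- rewrite Pz eqxx mulr1 big1 ?addr0 // => mu /negPf->.
  by rewrite mulr0 if_same.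
- exact: nseq_shapes.
- exact/words_uniq/iota_uniq.
Qed.

(** The product of the step operators, the head of [xs] outermost, acts on the indicator of the
    empty partition. *)
Fixpoint chainsum (r : rel (seq nat)) n (xs : seq R) : seq nat -> R :=
  match xs with
  | [::] => fun la => (la == nseq n 0%N)%:R
  | x :: xs' => stepop k.+1 n r x (chainsum r n xs')
  end.

(** Since E fixes the first row, reaching the empty partition forces [l = 0], hence [la] empty,
    where only the trivial filling exists. *)
Lemma elegop_delta n la : la \in shapes k.+1 n -> part la ->
  elegop k.+1 n (fun r => (r == nseq n 0%N)%:R : R) la = (la == nseq n 0%N)%:R.
Proof.
elim: n la => [|n IHn] [|l la] //; rewrite shapes_consP part_cons.
move=> /andP[lK laK] /andP[hl pla] /=; rewrite eqseq_cons.
case: (eqVneq l 0%N) hl => [-> hl /=|nz_l _]; last first.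
  apply: big1 => mu _; rewrite -[RHS](elegop0 R k.+1 n mu); apply: eq_elegop => r.
  by rewrite eqseq_cons (negPf nz_l).
transitivity (\sum_(mu <- shapes k.+1 n | subpart la mu)
    1 * (mu == nseq n 0%N)%:R : R).
  rewrite big_seq_cond [RHS]big_seq_cond; apply: eq_bigr => mu /andP[muK].
  move=> /andP[pmu _]; rewrite mul1r -IHn //; apply: eq_elegop => r.
rewrite sum_shapes_delta ?subpart_nseq0 // eq_sym.
have -> : nseq n 0%N == la; last by [].
move: laK; rewrite mem_shapes => /andP[/eqP sla _].
apply/eqP/(@eq_from_nth _ 0%N); rewrite size_nseq // => i _; rewrite nth_nseq if_same.
move: hl; rewrite leqn0 -nth0 => /eqP la0; elim: i => // i la_i.
by apply/esym/eqP; rewrite -leqn0 [X in (_ <= X)%N]la_i; apply: part_nth.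
Qed.

(** E is created at the empty partition by [elegop_delta] and then moved outwards through the
    operators by the commutation. *)
Lemma chainsum_elegop n xs la : la \in shapes k.+1 n -> part la ->
  chainsum subpart n xs la = elegop k.+1 n (chainsum hstrip n xs) la.
Proof.
elim: xs la => [|x xs IH] la laK pla /=; first by rewrite elegop_delta.
rewrite -stepop_elegop //; apply: eq_stepop => mu muK /andP[pmu _].
exact: IH.
Qed.

(** A horizontal strip cannot shorten the first row while the second has length [k]. Each strip can
    spoil only the last of the full rows of [la], so [t] of them suffice for [t] strips. *)
Lemma iter_hstripop_cons n t f la : (t <= n)%N -> size la = n ->
    take t la = nseq t k ->
  iter t (stepop k.+1 n.+1 hstrip 1) f (k :: la) =
  iter t (stepop k.+1 n hstrip 1) (fun mu => f (k :: mu)) la.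
Proof.
elim: t la => // t IHt la ltn sla la_k; rewrite !iterS hstripop_cons.
have hla : head 0%N la = k by case: la sla ltn la_k => [<-|l la _ _ []].
rewrite hla big_nat_recr //= big1_seq ?add0r => [|u]; last first.
  by rewrite mem_index_iota => /and3P[_ _ uk]; rewrite [leq k u]leqNgt uk mulr0.
rewrite !leqnn expr1n mul1r; apply: eq_stepop => mu.
rewrite mem_shapes => /andP[/eqP smu _] /andP[/andP[_ /leqs_nth le1] /leqs_nth le2].
have la_i i : (i < t.+1)%N -> nth 0%N la i = k.
  by move=> lti; rewrite -(nth_take _ lti) la_k nth_nseq lti.
apply: IHt => //; first exact: ltnW.
apply: (@eq_from_nth _ 0%N); first by rewrite size_takel ?size_nseq // smu ltnW.
rewrite size_takel ?smu; last exact: ltnW.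
move=> i lti; rewrite nth_take // nth_nseq lti.
apply/eqP; rewrite eqn_leq; have := le1 i; rewrite la_i => [->|] /=; last exact: ltnW.
by have := le2 i; rewrite nth_behead la_i.
Qed.

(** The first nested sum of E is C(1) on the rows below the first; commuting it with the E of these
    rows gives one U(1), and induction gives the others. The first row stays full by
    [iter_hstripop_cons]. *)
Lemma elegop_rect n f : elegop k.+1 n.+1 f (nseq n.+1 k) =
  iter n (stepop k.+1 n.+1 hstrip 1) f (nseq n.+1 k).
Proof.
elim: n f => [|n IHn] f.
  by rewrite /= big_shapes0.
transitivity (stepop k.+1 n.+1 subpart 1 (elegop k.+1 n.+1 (fun r => f (k :: r)))
    (nseq n.+1 k)).
  by apply: eq_bigr => mu _; rewrite expr1n mul1r.
rewrite stepop_elegop ?nseq_shapes ?part_nseq // IHn -iterSr.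
have sn : size (nseq n.+1 k) = n.+1 by rewrite size_nseq.
by rewrite [nseq n.+2 k]/= iter_hstripop_cons // take_oversize // sn.
Qed.

Lemma chainsum_cat_nseq r n t x xs :
  chainsum r n (nseq t x ++ xs) = iter t (stepop k.+1 n r x) (chainsum r n xs).
Proof. by elim: t => //= t ->. Qed.

Lemma chainsum_rect n xs : (0 < n)%N ->
  chainsum subpart n xs (nseq n k) =
  chainsum hstrip n (nseq n.-1 1 ++ xs) (nseq n k).
Proof.
case: n => // n _; rewrite chainsum_elegop ?nseq_shapes ?part_nseq //.
by rewrite elegop_rect chainsum_cat_nseq.
Qed.

(** The default of [head] closes the chain with the empty partition. *)
Fixpoint chainwt n (xs : seq R) (Ls : seq (seq nat)) : R :=
  match xs, Ls with
  | x :: xs', L :: Ls' =>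
      x ^+ ncols L (head (nseq n 0%N) Ls') * chainwt n xs' Ls'
  | _, _ => 1
  end.

Lemma chainsumE (r : rel (seq nat)) n x xs la :
  \sum_(Ls <- words (shapes k.+1 n) (size xs)
          | path r la (rcons Ls (nseq n 0%N)))
     chainwt n (x :: xs) (la :: Ls) =
  chainsum r n (x :: xs) la.
Proof.
elim: xs x la => [|y xs IH] x la.
  rewrite big_words0 /= /stepop andbT mulr1; case: ifP => rla.
    by rewrite sum_shapes_delta.
  rewrite big_mkcond big1 // => mu _; case: ifP => // rmu.
  by case: eqVneq rmu => [->|]; rewrite ?rla ?mulr0.
rewrite big_wordsS [RHS]/= /stepop [RHS]big_mkcond; apply: eq_bigr => L _ /=.
case: ifP => rL /=; last by rewrite big_pred0.
by rewrite -big_distrr /= [X in _ * X]IH.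
Qed.

End Rectangle.

(** * Plane partitions as chains of shapes *)

Lemma uniq_shapes K n : uniq (shapes K n).
Proof. exact/words_uniq/iota_uniq. Qed.

Lemma nth_nseq0 n i : nth 0%N (nseq n 0%N) i = 0%N.
Proof. by rewrite nth_nseq if_same. Qed.

Lemma leq_ltnP a b : (forall j, (j < a)%N -> (j < b)%N) -> (a <= b)%N.
Proof. by case: a => // a /(_ a); apply. Qed.

Lemma eq_ltnP a b : (forall j, (j < a)%N = (j < b)%N) -> a = b.
Proof.
by move=> ab; apply/eqP; rewrite eqn_leq !leq_ltnP // => j; rewrite ab.
Qed.

Lemma sorted_leqs la Ls :
  path subpart la Ls -> sorted (fun ka mu => leqs mu ka) Ls.
Proof.
by move/path_sorted; apply: sub_sorted => ka mu /andP[].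
Qed.

(* The [l]-th shape of a chain (counted from 0) is the set of boxes with
   entries greater than [l]. *)
Definition chain_array (Ls : seq (seq nat)) : array :=
  fun i j => count (fun L => j < nth 0 L i)%N Ls.

(** The shapes decrease, so those containing a given box form an initial segment of the chain.
    Beyond its end the default is the empty shape. *)
Lemma ltn_chain_array n Ls l i j : sorted (fun la mu => leqs mu la) Ls ->
  (l < chain_array Ls i j)%N = (j < nth 0 (nth (nseq n 0) Ls l) i)%N.
Proof.
elim: Ls l => [|L Ls IH] l; first by rewrite nth_nil nth_nseq0.
move=> sL; have {}IH l' := IH l' (path_sorted sL).
rewrite /chain_array /= -/(chain_array Ls i j).
have [jL|Lj] /= := ltnP j (nth 0%N L i); first by case: l => [|l] //=;
  rewrite ltnS IH.
have c0 : chain_array Ls i j = 0%N.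
  apply/eqP; rewrite -leqn0 leqNgt IH -leqNgt; apply: leq_trans Lj.
  by case: Ls sL {IH} => [|L' Ls] /=; [rewrite nth_nseq0 | move=> /andP[/leqs_nth]].
by case: l => [|l]; [rewrite c0 [RHS]ltnNge Lj | rewrite -IH c0].
Qed.

(** By monotonicity, having at most [k] nonzero columns means vanishing from column index [k] on;
    likewise for rows. *)
Definition boxed_pp k n m (pi : array) : Prop :=
  [/\ forall i j, (n <= i)%N -> pi i j = 0%N,
      forall i j, (k <= j)%N -> pi i j = 0%N,
      forall i j, (pi i.+1 j <= pi i j)%N,
      forall i j, (pi i j.+1 <= pi i j)%N
    & forall i j, (pi i j <= m)%N].

Lemma boxed_ppP k n m pi : boxed_pp k n m pi <-> PP k n m pi.
Proof.
have bound k' (A : set nat) : (forall a, A a -> a < k')%N -> (A #<= `I_k')%card.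
  by move=> Ak; apply: subset_card_le => a /Ak.
split=> [[row0 col0 dr dc le_m]|PPpi].
  split; [split=> //; [split=> //|]|].
  - apply: (@sub_finite_set _ _ [set` [seq (i, j) | i <- iota 0 n, j <- iota 0 k]]).
      move=> [i j] /= pi_gt0; apply/allpairsP; exists (i, j); rewrite !mem_iota /=.
      split=> //; rewrite ltnNge; apply/negP => le_ij; move: pi_gt0.
        by rewrite /Defs.support /= row0.
      by rewrite /Defs.support /= col0.
    exact: finite_seq.
  - apply: bound => i [j]; apply: contraTT; rewrite -!leqNgt => /row0->; exact: leqnn.
  - apply: bound => j [i]; apply: contraTT; rewrite -!leqNgt => /col0->; exact: leqnn.
have [[[_ dr dc] _ le_m] _] := PPpi.
split=> // i j; last exact: PP_col0 PPpi.
by case: PPpi => + _; apply: PPinf_row0.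
Qed.

Lemma boxed_pp_col k n m pi i j j' : boxed_pp k n m pi -> (j' <= j)%N ->
  (pi i j <= pi i j')%N.
Proof.
by move=> /boxed_ppP[[pp_pi _ _] _] le_j; apply: plane_partition_le.
Qed.

Lemma mem_chains K n m Ls l : Ls \in words (shapes K n) m -> (l < m)%N ->
  nth (nseq n 0%N) Ls l \in shapes K n.
Proof.
rewrite mem_words => /andP[/eqP sLs /allP LsK] lm; apply: LsK.
by rewrite mem_nth ?sLs.
Qed.

Lemma nth_shapes K n la i : la \in shapes K.+1 n -> (nth 0 la i <= K)%N.
Proof.
rewrite mem_shapes => /andP[_ /allP laK]; have [lti|gei] := ltnP i (size la).
  exact: laK (mem_nth _ lti).
by rewrite nth_default.
Qed.

Lemma boxed_pp_chain k n m Ls : Ls \in words (shapes k.+1 n) m ->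
  path subpart (nseq n k) Ls -> boxed_pp k n m (chain_array Ls).
Proof.
move=> LsK pLs; have keyP l i j := ltn_chain_array n l i j (sorted_leqs pLs).
have sLs : size Ls = m by move: LsK; rewrite mem_words => /andP[/eqP].
have nthK l : nth (nseq n 0%N) Ls l \in shapes k.+1 n.
  have [lm|ml] := ltnP l m; first exact: mem_chains LsK lm.
  by rewrite nth_default ?sLs // nseq_shapes.
have nthP l : part (nth (nseq n 0%N) Ls l).
  have [lm|ml] := ltnP l m; last by rewrite nth_default ?sLs ?part_nseq.
  move/(pathP (nseq n 0%N)): pLs => /(_ l); rewrite sLs => /(_ lm).
  by case/andP.
split=> [i j ni|i j kj|i j|i j|i j].
- apply/eqP; rewrite -leqn0; apply: leq_ltnP => l;
    rewrite keyP [X in (_ < X)%N]nth_default //.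
  by have := nthK l; rewrite mem_shapes => /andP[/eqP->].
- apply/eqP; rewrite -leqn0; apply: leq_ltnP => l; rewrite keyP => jl.
  have := leq_trans jl (nth_shapes _ (nthK l)); lia.
- apply: leq_ltnP => l; rewrite !keyP => /leq_trans; apply.
  exact: part_nth.
- by apply: leq_ltnP => l; rewrite !keyP; apply: ltnW.
- by rewrite -sLs count_size.
Qed.

Lemma count_ltn (p : pred nat) k j : (forall j, p j.+1 -> p j) ->
  (forall j, (k <= j)%N -> ~~ p j) -> (j < count p (iota 0 k))%N = p j.
Proof.
move=> decp p0; have decp' a b : (a <= b)%N -> p b -> p a.
  elim: b => [|b IH]; first by rewrite leqn0 => /eqP->.
  rewrite leq_eqVlt => /orP[/eqP-> //|ab /decp]; exact: IH.
have countE t : (count p (iota 0 t) <= t)%N by rewrite -{2}(size_iota 0 t) count_size.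
have cat t : (t <= k)%N -> count p (iota 0 k) =
  (count p (iota 0 t) + count p (iota t (k - t)))%N.
  by move=> tk; rewrite -count_cat -iotaD subnKC.
apply/idP/idP => [|pj].
  apply: contraTT => npj; rewrite -leqNgt.
  have [jk|kj] := leqP j k; last exact: leq_trans (countE k) (ltnW kj).
  rewrite (cat j) // (_ : count p (iota j _) = 0)%N ?addn0 //.
  apply/eqP; rewrite -leqn0 leqNgt -has_count; apply/hasPn => b.
  rewrite mem_iota => /andP[jb _]; apply: contra npj; exact: decp'.
have jk : (j < k)%N by rewrite ltnNge; apply: contraL pj => /p0.
rewrite (cat j.+1) //; apply: leq_trans (leq_addr _ _).
have : all p (iota 0 j.+1).
  by apply/allP => b; rewrite mem_iota ltnS => /andP[_ bj]; exact: decp' pj.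
by rewrite all_count size_iota => /eqP->.
Qed.

Lemma chain_array_onto k n m pi : boxed_pp k n m pi ->
  exists Ls, [/\ Ls \in words (shapes k.+1 n) m, path subpart (nseq n k) Ls
    & chain_array Ls = pi].
Proof.
move=> [row0 col0 dr dc le_m].
(* [L l] is the level set of the boxes with entry greater than [l]. *)
pose L l := mkseq (fun i => count (fun j => l < pi i j)%N (iota 0 k)) n.
have LE l i j : (j < nth 0 (L l) i)%N = (l < pi i j)%N.
  have [lti|gei] := ltnP i n; last by rewrite nth_default ?size_mkseq // row0.
  rewrite nth_mkseq // count_ltn // => j' ; first by move/leq_trans; apply.
  by move=> /col0->.
have partL l : part (L l).
  by apply: part_nthP => i; apply: leq_ltnP => j; rewrite !LE => /leq_trans; apply.
have LK l : L l \in shapes k.+1 n.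
  rewrite mem_shapes size_mkseq eqxx; apply/allP => u /mapP[i _ ->] /=.
  by rewrite ltnS -{2}(size_iota 0 k) count_size.
have pL : path subpart (nseq n k) (mkseq L m).
  apply/(pathP (nseq n k)) => l; rewrite size_mkseq => lm; rewrite nth_mkseq //.
  rewrite /subpart partL; apply/leqs_nth => i; case: l lm => [|l] lm.
    rewrite nth_nseq; have [lti|gei] := ltnP i n;
      last by rewrite nth_default ?size_mkseq.
    exact: nth_shapes (LK _).
  rewrite [nth _ _ _.+1]/= nth_mkseq; last exact: ltnW.
  by apply: leq_ltnP => j; rewrite !LE; apply: ltnW.
exists (mkseq L m); split=> //.
  rewrite mem_words size_mkseq eqxx; apply/allP => _ /mapP[l _ ->]; exact: LK.
apply/funext => i; apply/funext => j; apply: eq_ltnP => l.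
rewrite (ltn_chain_array n _ _ _ (sorted_leqs pL)).
have [lm|ml] := ltnP l m; first by rewrite nth_mkseq // LE.
rewrite [nth (nseq n 0%N) _ _]nth_default ?size_mkseq // nth_nseq0; apply/esym/negbTE.
by rewrite -leqNgt; apply: leq_trans ml.
Qed.

Lemma chain_array_inj k n m Ls Ls' :
    Ls \in words (shapes k n) m -> Ls' \in words (shapes k n) m ->
    sorted (fun la mu => leqs mu la) Ls -> sorted (fun la mu => leqs mu la) Ls' ->
  chain_array Ls = chain_array Ls' -> Ls = Ls'.
Proof.
move=> LsK Ls'K sLs sLs' eqLs; have nthK := mem_chains LsK;
  have nthK' := mem_chains Ls'K.
move: LsK Ls'K; rewrite !mem_words => /andP[/eqP s _] /andP[/eqP s' _].
apply: (@eq_from_nth _ (nseq n 0%N)); rewrite s ?s' // => l lm.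
have := nthK' l lm; have := nthK l lm; rewrite !mem_shapes.
move=> /andP[/eqP sl _] /andP[/eqP sl' _].
apply: (@eq_from_nth _ 0%N); rewrite sl ?sl' // => i lti.
by apply: eq_ltnP => j; rewrite -!ltn_chain_array // eqLs.
Qed.

Lemma fsbig_list (R : nmodType) (T : choiceType) (A : set T) (r : seq T)
    (F : T -> R) :
  uniq r -> (forall x, x \in r <-> A x) ->
  \sum_(x \in A) F x = \sum_(x <- r) F x.
Proof.
move=> ur rA; have -> : A = [set` r]%classic.
  by rewrite predeqE => x; split=> /rA.
by rewrite -fsbig_seq.
Qed.

Lemma fsbig_chains (R : nmodType) (A : set array) k n m
    (P : pred (seq (seq nat))) (F : array -> R) :
    (forall Ls, P Ls -> sorted (fun la mu => leqs mu la) Ls) ->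
    (forall Ls, Ls \in words (shapes k n) m -> P Ls -> A (chain_array Ls)) ->
    (forall pi, A pi ->
      exists Ls, [/\ Ls \in words (shapes k n) m, P Ls & chain_array Ls = pi]) ->
  \sum_(pi \in A) F pi = \sum_(Ls <- words (shapes k n) m | P Ls) F (chain_array Ls).
Proof.
move=> sP PA AP; rewrite -[RHS]big_filter.
transitivity (\sum_(pi <- map chain_array [seq Ls <- words (shapes k n) m | P Ls])
  F pi); last by rewrite big_map.
apply: fsbig_list => [|pi].
  rewrite map_inj_in_uniq; first exact/filter_uniq/words_uniq/uniq_shapes.
  move=> Ls Ls'; rewrite !mem_filter => /andP[/sP s LsK] /andP[/sP s' LsK'].
  exact: (chain_array_inj LsK LsK').
split=> [/mapP[Ls] | /AP[Ls [LsK PLs <-]]].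
  by rewrite mem_filter => /andP[PLs LsK] ->; apply: PA.
by apply: map_f; rewrite mem_filter PLs.
Qed.

Lemma sum_PP (R : nmodType) k n m (F : array -> R) :
  \sum_(pi \in PP k n m) F pi =
  \sum_(Ls <- words (shapes k.+1 n) m | path subpart (nseq n k) Ls)
     F (chain_array Ls).
Proof.
apply: fsbig_chains => [Ls|Ls LsK pLs|pi /boxed_ppP /chain_array_onto //].
  exact: sorted_leqs.
by apply/boxed_ppP; apply: boxed_pp_chain.
Qed.

Lemma rect_shapeP k n m pi : boxed_pp k n m pi ->
  has_shape pi (nseq n k) <-> forall i j, (i < n)%N -> (j < k)%N -> (0 < pi i j)%N.
Proof.
move=> [row0 col0 _ _ _]; split=> [sh i j lti ltj|pos].
  have : young_diagram (nseq n k) (i, j) by rewrite /young_diagram /= nth_nseq lti.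
  by rewrite -sh.
rewrite /has_shape predeqE => -[i j];
  rewrite /Defs.support /young_diagram /= nth_nseq.
case: (ltnP i n) => lti; last by rewrite row0.
by split; [rewrite !ltnNge; apply: contra => /col0->; exact: leqnn | exact: pos].
Qed.

Lemma PP'_boxed k n m pi :
  PP' k n m pi <-> boxed_pp k n m pi /\ has_shape pi (nseq n k).
Proof.
split=> [[pp_pi sh le_m]|[bpi sh]]; last first.
  by move: (bpi) => /boxed_ppP[[pp_pi _ le_m] _].
have supp i j : ~~ ((i < n) && (j < k))%N -> pi i j = 0%N.
  apply: contraNeq; rewrite -lt0n => pi_gt0.
  have: young_diagram (nseq n k) (i, j) by rewrite -sh.
  by rewrite /young_diagram /= nth_nseq; case: ifP.
case: pp_pi => _ dr dc; split=> //; split=> // i j; rewrite leqNgt => /negPf C.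
  by rewrite supp // C.
by rewrite supp // C andbF.
Qed.

Lemma subpart_refl la : part la -> subpart la la.
Proof. by rewrite /subpart leqs_refl andbT. Qed.

(** The shape is the full rectangle exactly when the first level set is, so only the other [m]
    shapes vary. *)
Lemma sum_PP' (R : nmodType) k n m (F : array -> R) :
  \sum_(pi \in PP' k n m.+1) F pi =
  \sum_(Ls <- words (shapes k.+1 n) m | path subpart (nseq n k) Ls)
     F (chain_array (nseq n k :: Ls)).
Proof.
set rho := nseq n k; have rhoK : rho \in shapes k.+1 n by apply: nseq_shapes.
transitivity (\sum_(Ls <- words (shapes k.+1 n) m.+1
    | (head [::] Ls == rho) && path subpart rho Ls) F (chain_array Ls)); last first.
  rewrite big_wordsS (bigD1_seq rho) ?uniq_shapes //= [X in _ + X]big1 ?addr0 =>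
    [|L /negPf neqL].
    by under eq_bigl do rewrite eqxx subpart_refl ?part_nseq //.
  by rewrite big_pred0 // => Ls; rewrite neqL.
apply: fsbig_chains => [Ls /andP[_]|Ls LsK /andP[/eqP hLs pLs]|pi].
- exact: sorted_leqs.
- apply/PP'_boxed; have bLs := boxed_pp_chain LsK pLs; split=> //.
  apply/(rect_shapeP bLs) => i j lti ltj.
  rewrite (ltn_chain_array n _ _ _ (sorted_leqs pLs)).
  case: Ls LsK hLs {pLs bLs} => [|L Ls]; first by rewrite mem_words.
  by move=> _ /= ->; rewrite nth_nseq lti.
- move=> /PP'_boxed[bpi /(rect_shapeP bpi) pos]; have [row0 _ _ _ _] := bpi.
  have [Ls [LsK pLs eqLs]] := chain_array_onto bpi.
  exists Ls; split=> //; rewrite pLs andbT.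
  case: Ls LsK pLs eqLs => [|L Ls] LsK pLs eqLs; first by rewrite mem_words in LsK.
  have LK : L \in shapes k.+1 n by exact: (mem_chains (l:=0) LsK).
  have sL : size L = n by move: LK; rewrite mem_shapes => /andP[/eqP].
  apply/eqP/(@eq_from_nth _ 0%N); rewrite /= sL ?size_nseq // => i lti.
  rewrite nth_nseq lti; apply/eqP; rewrite eqn_leq (nth_shapes _ LK) //=.
  apply: leq_ltnP => j ltj; have := pos i j lti ltj.
  by rewrite -eqLs (ltn_chain_array n _ _ _ (sorted_leqs pLs)).
Qed.

(** * Corner volumes *)

Lemma sum_nat_between a l k : (l <= k)%N ->
  (\sum_(0 <= j < k) ((a <= j) && (j < l)) = l - a)%N.
Proof.
move=> lk; rewrite -[RHS]muln1 -sum_nat_const_nat.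
rewrite [RHS](big_nat_widen _ _ k) // [RHS](big_nat_widenl _ 0%N) // [RHS]big_mkcond.
by apply: eq_bigr => j _; rewrite andbC /=; case: (_ && _).
Qed.

(** Each nonempty column of the skew shape is counted at its lowest box. *)
Lemma ncols_sum n k la mu : size la = n -> size mu = n ->
    (forall i, nth 0 la i <= k)%N ->
  ncols la mu = (\sum_(0 <= i < n) \sum_(0 <= j < k)
    ((maxn (nth 0 mu i) (nth 0 la i.+1) <= j) && (j < nth 0 la i)))%N.
Proof.
elim: n la mu => [|n IHn] [|l la] [|u mu] //=; first by rewrite big_geq.
move=> [sla] [smu] lak; rewrite big_nat_recl //= sum_nat_between ?(lak 0%N) //.
rewrite nth0 (IHn la mu) // => i; exact: (lak i.+1).
Qed.

Section Weights.
Variable R : comNzRingType.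
Implicit Types (xs : seq R) (pi : array).

Lemma chainwt_prod n xs Ls : size Ls = size xs ->
  chainwt n xs Ls = \prod_(0 <= l < size xs)
    nth 1 xs l ^+ ncols (nth (nseq n 0%N) Ls l) (nth (nseq n 0%N) Ls l.+1).
Proof.
elim: xs Ls => [|x xs IH] [|L Ls] //=; first by rewrite big_geq.
by move=> [sLs]; rewrite big_nat_recl //= nth0 IH.
Qed.

(** A refinement of the corner volume weight: a descent with entry [v] contributes the [v]-th
    variable, stored at index [v - 1]. *)
Definition ppweight k n xs pi : R :=
  \prod_(0 <= i < n) \prod_(0 <= j < k)
    (if (pi i.+1 j < pi i j)%N then nth 1 xs (pi i j).-1 else 1).

Lemma chainwt_array k n xs Ls :
    Ls \in words (shapes k.+1 n) (size xs) -> path subpart (nseq n k) Ls ->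
  chainwt n xs Ls = ppweight k n xs (chain_array Ls).
Proof.
move=> LsK pLs; have keyP l i j := ltn_chain_array n l i j (sorted_leqs pLs).
have [_ _ dr _ le_m] := boxed_pp_chain LsK pLs.
have sLs : size Ls = size xs by move: LsK; rewrite mem_words => /andP[/eqP].
have nthK l : nth (nseq n 0%N) Ls l \in shapes k.+1 n.
  have [lm|ml] := ltnP l (size xs); first exact: mem_chains LsK lm.
  by rewrite nth_default ?sLs // nseq_shapes.
have nth_size l : size (nth (nseq n 0%N) Ls l) = n.
  by have := nthK l; rewrite mem_shapes => /andP[/eqP].
pose pi := chain_array Ls.
(* [b l i j] says that box [(i, j)] is the lowest one of its column in the [l]-th skew shape. It
   forces a descent with entry [l + 1], so each descent is met for exactly one [l]. *)
pose b l i j := [&& pi i.+1 j <= l, pi i j <= l.+1 & l < pi i j]%N.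
transitivity (\prod_(0 <= l < size xs) \prod_(0 <= i < n) \prod_(0 <= j < k)
  nth 1 xs l ^+ b l i j).
  rewrite chainwt_prod //; apply: eq_bigr => l _.
  rewrite (@ncols_sum n k) // => [|i]; last exact: nth_shapes (nthK l).
  rewrite expr_sum; apply: eq_bigr => i _; rewrite expr_sum; apply: eq_bigr => j _.
  congr (_ ^+ nat_of_bool _); rewrite /b geq_max !(leqNgt _ j) -!keyP -!leqNgt.
  by rewrite -/pi -andbA andbCA.
rewrite exchange_big; apply: eq_bigr => i _; rewrite exchange_big;
  apply: eq_bigr => j _.
rewrite -/pi /=; case: ifP => des; last first.
  by apply: big1 => l _; have -> : b l i j = false by rewrite /b; lia.
have pos : (0 < pi i j)%N by apply: leq_trans des.
rewrite (bigD1_seq (pi i j).-1) ?iota_uniq //=; last first.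
  by rewrite mem_index_iota /= prednK.
have -> : b (pi i j).-1 i j by rewrite /b; lia.
rewrite big1 ?mulr1 // => l nl; have -> // : b l i j = false.
by rewrite /b; lia.
Qed.

Lemma corner_volumeE k n m pi : boxed_pp k n m pi ->
  corner_volume pi = (\sum_(0 <= i < n) \sum_(0 <= j < k)
    (if pi i.+1 j < pi i j then pi i j else 0))%N.
Proof.
move=> [row0 col0 _ _ _].
rewrite /corner_volume (@fsbigE _ _ _ _ _
  [seq c <- [seq (i, j) | i <- iota 0 n,
    j <- iota 0 k] | pi c.1.+1 c.2 < pi c.1 c.2]%N).
- rewrite -big_filter (_ : [seq i <- _ | _] = [seq c <-
      [seq (i, j) | i <- iota 0 n, j <- iota 0 k] | pi c.1.+1 c.2 < pi c.1 c.2]%N).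
    by rewrite big_filter big_mkcond big_allpairs /= /index_iota !subn0.
  apply/all_filterP/allP => c; rewrite mem_filter => /andP[des _].
  by rewrite inE /Des /=.
- apply/filter_uniq/allpairs_uniq; rewrite ?iota_uniq // => -[a b] [c d] _ _ /= //.
- by move=> c /=; rewrite mem_filter => /andP[].
- move=> [i j]; rewrite /Des /= mem_filter => /= des; rewrite des /=.
  move=> out; exfalso; move/negP: out; apply; apply/allpairsP; exists (i, j).
  rewrite !mem_iota /=; split=> //; rewrite ltnNge add0n; apply/negP => le_ij;
    move: des.
    by rewrite (row0 i) ?ltn0.
  by rewrite (col0 i) ?ltn0.
Qed.

Definition qpows (q : R) m := [seq q ^+ i.+1 | i <- iota 0 m].

Lemma ppweight_qpow (q : R) k n m pi : boxed_pp k n m pi ->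
  ppweight k n (qpows q m) pi = q ^+ corner_volume pi.
Proof.
move=> bpi; rewrite (corner_volumeE bpi) expr_sum; apply: eq_bigr => i _.
rewrite expr_sum; apply: eq_bigr => j _; case: ifP => // des.
have pos : (0 < pi i j)%N by apply: leq_trans des.
have ltm : ((pi i j).-1 < m)%N by rewrite prednK //; case: bpi.
by rewrite (nth_map 0%N) ?size_iota // nth_iota // add0n prednK.
Qed.

(** The step from the bounding rectangle to the first level set has weight 1, whence the additional
    parameter. *)
Lemma sum_PP_qpow (q : R) k n m :
  \sum_(pi \in PP k n m) q ^+ corner_volume pi =
  chainsum k subpart n (1 :: qpows q m) (nseq n k).
Proof.
rewrite sum_PP -chainsumE size_map size_iota big_seq_cond [RHS]big_seq_cond.
apply: eq_big => [Ls|Ls /andP[LsK pLs]].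
  by rewrite rcons_path subpart_nseq0 andbT.
rewrite [RHS]/= expr1n mul1r (@chainwt_array k) ?size_map ?size_iota //.
by rewrite (@ppweight_qpow _ _ _ m) //; apply: boxed_pp_chain.
Qed.

Lemma sum_PP'_qpow (q : R) k n m : (0 < m)%N ->
  \sum_(pi \in PP' k n m) q ^+ corner_volume pi =
  chainsum k subpart n (qpows q m) (nseq n k).
Proof.
case: m => // m _; have -> : qpows q m.+1 = q ^+ 1 :: [seq q ^+ i.+2 | i <- iota 0 m].
  by rewrite /qpows /= (iotaDl 1 0) -map_comp.
rewrite sum_PP' -chainsumE size_map size_iota big_seq_cond [RHS]big_seq_cond.
apply: eq_big => [Ls|Ls /andP[LsK pLs]].
  by rewrite rcons_path subpart_nseq0 andbT.
have LsK' : nseq n k :: Ls \in words (shapes k.+1 n) m.+1.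
  move: LsK; rewrite !mem_words /= eqSS => /andP[-> ->].
  by rewrite andbT; apply: nseq_shapes.
have pLs' : path subpart (nseq n k) (nseq n k :: Ls).
  by rewrite /= subpart_refl // part_nseq.
have -> : q ^+ 1 :: [seq q ^+ i.+2 | i <- iota 0 m] = qpows q m.+1.
  by rewrite /qpows /= (iotaDl 1 0) -map_comp.
rewrite (@chainwt_array k) ?size_map ?size_iota //.
by rewrite (@ppweight_qpow _ _ _ m.+1) //; apply: boxed_pp_chain.
Qed.

End Weights.

(** * Schur polynomials of rectangles *)

Lemma nth_rcons_default (T : Type) (z : T) s l : nth z (rcons s z) l = nth z s l.
Proof.
by rewrite nth_rcons; case: ltngtP => // sl; rewrite nth_default // ?sl // ltnW.
Qed.

Definition colstrict k n (pi : array) : bool :=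
  all (fun i => all (fun j => pi i.+1 j < pi i j)%N (iota 0 k)) (iota 0 n).

Lemma colstrictP k n pi :
  reflect (forall i j, i < n -> j < k -> pi i.+1 j < pi i j)%N (colstrict k n pi).
Proof.
apply: (iffP allP) => [cs i j lti ltj|cs i].
  have := cs i; rewrite mem_iota => /(_ lti) /allP /(_ j).
  by rewrite mem_iota => /(_ ltj).
rewrite mem_iota => lti; apply/allP => j; rewrite mem_iota => ltj; exact: cs.
Qed.

(** Interlacing of consecutive level sets says that an entry greater than [l] has an entry greater
    than [l + 1] just above it, which is strict decrease down the columns. *)
Lemma path_hstripE k n m Ls : Ls \in words (shapes k.+1 n) m ->
  path hstrip (nseq n k) (rcons Ls (nseq n 0%N)) =
  path subpart (nseq n k) Ls && colstrict k n (chain_array (nseq n k :: Ls)).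
Proof.
set rho := nseq n k; set z := nseq n 0%N => LsK.
have sLs : size Ls = m by move: LsK; rewrite mem_words => /andP[/eqP].
pose full l := nth z (rho :: Ls) l.
have pathE (r : rel (seq nat)) :
    reflect (forall l, (l <= m)%N -> r (full l) (full l.+1)) (path r rho (rcons Ls z)).
  have fullE l : nth z (rho :: rcons Ls z) l = full l.
    by case: l => //= l; rewrite nth_rcons_default.
  apply: (iffP (pathP z)) => r_l l lm.
    have := r_l l; rewrite size_rcons sLs ltnS => /(_ lm).
    by rewrite fullE nth_rcons_default.
  by rewrite nth_rcons_default fullE; apply: r_l; rewrite size_rcons sLs ltnS in lm.
have subE : path subpart rho Ls = path subpart rho (rcons Ls z).
  by rewrite rcons_path subpart_nseq0 andbT.
have [pLs|npLs] := boolP (path subpart rho Ls); last first.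
  apply: contraNF npLs; rewrite subE; apply: sub_path => la mu; by case/andP.
have pLs' : path subpart rho (rho :: Ls) by rewrite /= subpart_refl // part_nseq.
have LsK' : rho :: Ls \in words (shapes k.+1 n) m.+1.
  move: LsK; rewrite !mem_words /= eqSS => /andP[-> ->].
  by rewrite andbT; apply: nseq_shapes.
have [row0 col0 _ _ le_m] := boxed_pp_chain LsK' pLs'.
have keyP l i j : (l < chain_array (rho :: Ls) i j)%N = (j < nth 0 (full l) i)%N.
  by rewrite (ltn_chain_array n l i j (sorted_leqs pLs')).
rewrite subE in pLs; move/pathE: pLs => subl /=.
apply/pathE/colstrictP => [hl i j lti ltj|cs l lm].
  case E: (chain_array (rho :: Ls) i.+1 j) => [|l].
    by rewrite keyP /full nth_nseq lti.
  have lm : (l <= m)%N by rewrite -ltnS -E.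
  have /andP[_ /leqs_nth le] := hl _ lm.
  rewrite keyP; apply: leq_trans (le i); rewrite nth_behead -keyP E; exact: leqnn.
rewrite /hstrip subl //; apply/leqs_nth => i; rewrite nth_behead.
apply: leq_ltnP => j; rewrite -!keyP => pos.
apply: (leq_ltn_trans pos (cs i j _ _)).
  by rewrite ltnNge; apply: contraL pos => ni; rewrite row0 // ltnW.
by rewrite ltnNge; apply: contraL pos => kj; rewrite col0.
Qed.

Section SchurRectangle.
Variables (R : comNzRingType) (N k n : nat).
Local Notation rect := (nseq n k).
Implicit Types (pi : array) (T : {ffun box rect -> 'I_N}).

Lemma box_row_lt (b : box rect) : (box_row b < n)%N.
Proof. by rewrite -[X in (_ < X)%N](size_nseq n k); apply: ltn_ord. Qed.

Lemma box_col_lt (b : box rect) : (box_col b < k)%N.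
Proof.
have := ltn_ord (tagged b); rewrite -/(box_col b) nth_nseq -/(box_row b).
by rewrite box_row_lt.
Qed.

Lemma box_lt (b : box rect) : (box_row b < n)%N && (box_col b < k)%N.
Proof. by rewrite box_row_lt box_col_lt. Qed.

Lemma box_ex i j : (i < n)%N -> (j < k)%N ->
  exists b : box rect, box_row b = i /\ box_col b = j.
Proof.
move=> lti ltj; have lti' : (i < size rect)%N by rewrite size_nseq.
have ltj' : (j < nth 0 rect (Ordinal lti'))%N by rewrite nth_nseq lti.
by exists (Tagged (fun i : 'I_(size rect) => 'I_(nth 0%N rect i)) (Ordinal ltj')).
Qed.

Lemma box_inj (b c : box rect) :
  box_row b = box_row c -> box_col b = box_col c -> b = c.
Proof.
case: b c => [i j] [i' j']; rewrite /box_row /box_col /= => /val_inj eqi.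
by subst i' => /val_inj ->.
Qed.

(* Rotating a tableau of rectangular shape by a half turn and adding one to its
   entries yields a column-strict plane partition. *)
Definition tableau_array T : array := fun i j =>
  if [pick b : box rect | (i + box_row b == n.-1) && (j + box_col b == k.-1)]%N
    is Some b then (T b).+1 else 0%N.

Lemma tableau_arrayE T (b : box rect) :
  tableau_array T (n - (box_row b).+1)%N (k - (box_col b).+1)%N = (T b).+1.
Proof.
have := box_row_lt b; have := box_col_lt b => ltj lti.
rewrite /tableau_array; case: pickP => [c /andP[/eqP ec /eqP er]|/(_ b)].
  by congr (T _).+1; apply: box_inj; lia.
by case: andP => // -[]; split; lia.
Qed.

Lemma tableau_array_out T i j : (n <= i)%N || (k <= j)%N -> tableau_array T i j = 0%N.
Proof.
move=> out; rewrite /tableau_array; case: pickP => // b /andP[/eqP ec /eqP er].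
by have := box_row_lt b; have := box_col_lt b; lia.
Qed.

Lemma box_rot i j : (i < n)%N -> (j < k)%N ->
  exists b : box rect, i = (n - (box_row b).+1)%N /\ j = (k - (box_col b).+1)%N.
Proof.
move=> lti ltj; have [||b [eb ec]] := @box_ex (n - i.+1) (k - j.+1); [lia|lia|].
by exists b; lia.
Qed.

Lemma semistandardP T : reflect
  (forall b c, (box_row b = box_row c -> box_col b < box_col c -> T b <= T c)%N /\
    (box_col b = box_col c -> box_row b < box_row c -> T b < T c)%N)
  (semistandard T).
Proof.
apply: (iffP forallP) => [sst b c|sst b].
  have /forallP /(_ c) /andP[/implyP r /implyP s] := sst b.
  by split=> /eqP e lt; [apply: r | apply: s]; rewrite e.
apply/forallP => c; have [r s] := sst b c.
by apply/andP; split; apply/implyP => /andP[/eqP]; [apply: r | apply: s].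
Qed.

(** The half turn reverses the inequalities along rows and columns; adding one makes all entries in
    the rectangle positive, so the shape is exact. *)
Lemma tableau_arrayP pi :
  pi \in [seq tableau_array T | T <- index_enum _ & semistandard T] <->
  PP' k n N pi /\ colstrict k n pi.
Proof.
split=> [/mapP[T] | [PPpi /colstrictP cs]].
  rewrite mem_filter => /andP[/semistandardP sst _] ->.
  have strict i j : (i < n)%N -> (j < k)%N ->
    (tableau_array T i.+1 j < tableau_array T i j)%N.
    move=> lti ltj; have [b [eb ec]] := box_rot lti ltj.
    rewrite {2}eb {2}ec tableau_arrayE ltnS.
    have [lti'|gei] := ltnP i.+1 n; last by rewrite tableau_array_out ?gei.
    have [c [eb' ec']] := box_rot lti' ltj.
    rewrite eb' ec' tableau_arrayE; have [_ s] := sst c b.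
    by apply: s; have := box_lt b; have := box_lt c; lia.
  split; last by apply/colstrictP => i j; apply: strict.
  have bT : boxed_pp k n N (tableau_array T).
    split=> [i j ni|i j kj|i j|i j|i j].
    - by rewrite tableau_array_out ?ni.
    - by rewrite tableau_array_out ?kj ?orbT.
    - have [out|] := boolP ((n <= i.+1)%N || (k <= j)%N);
        first by rewrite tableau_array_out.
      by rewrite negb_or -!ltnNge => /andP[lti ltj]; apply/ltnW/strict => //;
        apply: ltnW.
    - have [out|] := boolP ((n <= i)%N || (k <= j.+1)%N);
        first by rewrite tableau_array_out.
      rewrite negb_or -!ltnNge => /andP[lti ltj].
      have [b [eb ec]] := box_rot lti (ltnW ltj);
        have [c [eb' ec']] := box_rot lti ltj.
      rewrite {1}eb' ec' {1}eb {1}ec !tableau_arrayE ltnS; have [r _] := sst c b.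
      by apply: r; have := box_lt b; have := box_lt c; lia.
    - have [out|] := boolP ((n <= i)%N || (k <= j)%N);
        first by rewrite tableau_array_out.
      rewrite negb_or -!ltnNge => /andP[lti ltj]; have [b [-> ->]] := box_rot lti ltj.
      by rewrite tableau_arrayE.
  apply/PP'_boxed; split=> //; apply/(rect_shapeP bT) => i j lti ltj.
  exact: leq_ltn_trans (strict i j lti ltj).
have /PP'_boxed[bpi /(rect_shapeP bpi) pos] := PPpi; have [row0 col0 _ _ le_N] := bpi.
have [[pp_pi _ _] _] := (proj1 (boxed_ppP _ _ _ _) bpi).
pose v (b : box rect) := pi (n - (box_row b).+1)%N (k - (box_col b).+1)%N.
have v_gt0 b : (0 < v b)%N.
  by have := box_row_lt b; have := box_col_lt b => ? ?; apply: pos; lia.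
have v_lt b : ((v b).-1 < N)%N by rewrite prednK //; apply: le_N.
pose T : {ffun box rect -> 'I_N} := [ffun b => Ordinal (v_lt b)].
apply/mapP; exists T.
  rewrite mem_filter mem_index_enum andbT; apply/semistandardP => b c.
  have := box_lt b; have := box_lt c => ltc ltb.
  rewrite !ffunE /=; split=> [er lt|ec lt].
    suff : (v b <= v c)%N by lia.
    rewrite /v er; apply: boxed_pp_col bpi _; lia.
  suff : (v b < v c)%N by have := v_gt0 b; lia.
  rewrite /v ec; apply: leq_ltn_trans (cs (n - (box_row c).+1)%N _ _ _); [|lia|lia].
  by apply: plane_partition_le => //; lia.
apply/funext => i; apply/funext => j.
have [lti|ni] := ltnP i n; last by rewrite row0 // tableau_array_out ?ni.
have [ltj|kj] := ltnP j k; last by rewrite col0 // tableau_array_out ?kj ?orbT.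
by have [b [-> ->]] := box_rot lti ltj; rewrite tableau_arrayE ffunE /= prednK ?v_gt0.
Qed.

Lemma tableau_array_inj : injective tableau_array.
Proof.
move=> T T' eqT; apply/ffunP => b; apply/val_inj/succn_inj.
by rewrite -!tableau_arrayE eqT.
Qed.

(** By column strictness every box is a descent; the half turn [g] reindexes the product. *)
Lemma tableau_weight (pt : 'I_N -> R) T : colstrict k n (tableau_array T) ->
  \prod_(b : box rect) pt (T b) =
  ppweight k n [seq pt i | i <- enum 'I_N] (tableau_array T).
Proof.
move=> /colstrictP cs; set xs := [seq _ | _ <- _].
transitivity (\prod_(0 <= i < n) \prod_(0 <= j < k)
  nth 1 xs (tableau_array T i j).-1); last first.
  rewrite big_nat_cond [RHS]big_nat_cond; apply: eq_bigr => i; rewrite andbT => lti.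
  rewrite big_nat_cond [RHS]big_nat_cond; apply: eq_bigr => j; rewrite andbT => ltj.
  by rewrite cs.
pose g (b : box rect) := ((n - (box_row b).+1)%N, (k - (box_col b).+1)%N).
rewrite -(big_allpairs_dep (h := pair) (r2 := fun=> _)
  (F := fun c => nth 1 xs (tableau_array T c.1 c.2).-1)).
transitivity (\prod_(c <- map g (index_enum (box rect)))
  nth 1 xs (tableau_array T c.1 c.2).-1).
  rewrite big_map; apply: eq_bigr => b _; rewrite tableau_arrayE /=.
  by rewrite (nth_map (T b)) ?size_enum_ord // nth_ord_enum.
apply: perm_big; apply: uniq_perm.
- rewrite map_inj_uniq ?index_enum_uniq // => b c [].
  by have := box_lt b; have := box_lt c => ? ? ? ?; apply: box_inj; lia.
- by apply: allpairs_uniq; rewrite ?iota_uniq // => -[a b] [c d].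
- move=> [i j]; apply/mapP/allpairsP => [[b _ [-> ->]]|[[i' j'] [/=]]].
    exists (g b); rewrite /= !mem_index_iota; split=> //.
      by have := box_row_lt b; lia.
    by have := box_col_lt b; lia.
  rewrite !mem_index_iota => lti ltj [-> ->].
  have [b [-> ->]] := box_rot lti ltj; exists b => //; exact: mem_index_enum.
Qed.

Lemma schur_rect (pt : 'I_N -> R) : (0 < N)%N ->
  (schur R N rect).@[pt] = chainsum k hstrip n [seq pt i | i <- enum 'I_N] rect.
Proof.
move=> N_gt0; set xs := [seq _ | _ <- _].
have sxs : size xs = N by rewrite size_map size_enum_ord.
pose A : set array := fun pi => PP' k n N pi /\ colstrict k n pi.
transitivity (\sum_(pi \in A) ppweight k n xs pi).
  rewrite (@fsbig_list _ _ A _ _ _ tableau_arrayP).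
    rewrite big_map big_filter /schur rmorph_sum /= big_seq_cond [RHS]big_seq_cond.
    apply: eq_bigr => T /andP[_ sst]; rewrite rmorph_prod /=.
    under eq_bigr do rewrite mevalXU; apply: tableau_weight.
    suff /tableau_arrayP[] : tableau_array T \in
      [seq tableau_array T | T <- index_enum _ & semistandard T] by [].
    by apply: map_f; rewrite mem_filter sst mem_index_enum.
  by rewrite map_inj_uniq ?filter_uniq ?index_enum_uniq //; apply: tableau_array_inj.
transitivity (\sum_(pi \in PP' k n N)
  if colstrict k n pi then ppweight k n xs pi else 0).
  transitivity (\sum_(pi \in A) if colstrict k n pi then ppweight k n xs pi else 0).
    by apply: eq_fsbigr => pi /set_mem[_ ->].
  apply: fsbig_widen => [pi [] //|pi [PPpi nA] /=].
  by case: ifP => // cs; case: nA.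
case: xs sxs => [|x xs]; first by move=> /= N0; rewrite -N0 in N_gt0.
move=> [sxs]; rewrite -sxs sum_PP' -chainsumE.
rewrite big_mkcond [RHS]big_mkcond big_seq [RHS]big_seq; apply: eq_bigr => Ls LsK.
rewrite (path_hstripE LsK); case: ifP => //= pLs; case: ifP => // cs.
rewrite -[RHS]/(chainwt n (x :: xs) (rect :: Ls)) (@chainwt_array _ k) //.
  move: LsK; rewrite !mem_words /= eqSS => /andP[-> ->].
  by rewrite andbT; apply: nseq_shapes.
by rewrite /= subpart_refl // part_nseq.
Qed.

End SchurRectangle.

Lemma ones_qpowersE r m :
  [seq @ones_qpowers r m i | i <- enum 'I_(r + m)] = nseq r 1 ++ qpows 'X m.
Proof.
apply: (@eq_from_nth _ 0);
  first by rewrite size_cat size_nseq size_map size_enum_ord size_map size_iota.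
move=> i; rewrite size_map size_enum_ord => lti.
rewrite (nth_map (Ordinal lti)) ?size_enum_ord // (nth_ord_enum _ (Ordinal lti)).
rewrite nth_cat nth_nseq size_nseq /ones_qpowers.
case: splitP => /= [j ij|j ij].
  by rewrite ij ltn_ord.
by rewrite ij ltnNge leq_addr /= addKn (nth_map 0%N) ?size_iota // nth_iota.
Qed.

(** * Unbounded number of columns *)

Lemma ncols_head la mu : size la = size mu -> part mu ->
  (head 0 la <= ncols la mu + head 0 mu)%N.
Proof.
elim: la mu => [|l la IH] [|u mu] //= [sz]; rewrite part_cons => /andP[hu pmu].
by have := IH mu sz pmu; move: (ncols _ _) => c; lia.
Qed.

Section Order.
Variable R : comNzRingType.
Implicit Types f g x : fps R.

(** This is divisibility by the [e]-th power of the variable, used to state congruences with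
    truncated sums. *)
Definition ord_ge e f := forall d, (d < e)%N -> fcoef f d = 0.

Lemma ord_ge_le e e' f : (e <= e')%N -> ord_ge e' f -> ord_ge e f.
Proof. by move=> le f_ge d lt; apply: f_ge; apply: leq_trans le. Qed.

Lemma ord_ge_sum e (I : eqType) (r : seq I) (P : pred I) (F : I -> fps R) :
  (forall i, i \in r -> P i -> ord_ge e (F i)) -> ord_ge e (\sum_(i <- r | P i) F i).
Proof.
move=> F_ge; rewrite big_seq_cond;
  elim/big_ind: _ => [d //|f g f_ge g_ge d lt|i /andP[]].
  by rewrite fcoefD f_ge ?g_ge ?addr0.
exact: F_ge.
Qed.

Lemma ord_geM a b f g : ord_ge a f -> ord_ge b g -> ord_ge (a + b) (f * g).
Proof.
move=> f_ge g_ge d lt; rewrite fcoefM big1 // => -[i /= ltd] _.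
have [ia|ai] := ltnP i a; first by rewrite f_ge ?mul0r.
by rewrite g_ge ?mulr0 //; lia.
Qed.

Lemma ord_geMl b f g : ord_ge b g -> ord_ge b (f * g).
Proof. by move=> g_ge; rewrite -[b]add0n; apply: ord_geM. Qed.

Lemma ord_geB e f g : ord_ge e f -> ord_ge e g -> ord_ge e (f - g).
Proof. by move=> f_ge g_ge d lt; rewrite fcoefD fcoefN f_ge ?g_ge ?subr0. Qed.

Lemma ord_ge_exp x e : fcoef x 0 = 0 -> ord_ge e (x ^+ e).
Proof. by move=> x0 d lt; apply: fcoef_expr_small. Qed.

(** By [ncols_head] each step has order at least the decrease of the first row; these decreases
    telescope to the first row of [la]. *)
Lemma chainsum_ord_ge k n (xs : seq (fps R)) la : {in xs, forall x, fcoef x 0 = 0} ->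
  la \in shapes k.+1 n -> ord_ge (head 0%N la) (chainsum k subpart n xs la).
Proof.
elim: xs la => [|x xs IH] la xs0 laK /=.
  by case: eqVneq => [-> d|_ d //]; rewrite -nth0 nth_nseq0.
apply: ord_ge_sum => mu muK /andP[pmu _].
apply: (@ord_ge_le _ (ncols la mu + head 0%N mu)).
  apply: ncols_head => //; move: laK muK; rewrite !mem_shapes.
  by move=> /andP[/eqP-> _] /andP[/eqP-> _].
apply: ord_geM; first by apply/ord_ge_exp/xs0; rewrite inE eqxx.
by apply: IH => // y yxs; apply: xs0; rewrite inE yxs orbT.
Qed.

(* Given the smaller shape [mu], the rows of [la] are determined from the last
   one upwards by [la_i = max (mu_i, la_(i+1)) + d_i], with [d_i >= 0]
   arbitrary; bounding [la] by [K] costs an error of order [K - mu_1]. *)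
Lemma sum_above k n x mu : fcoef x 0 = 0 -> mu \in shapes k.+1 n -> part mu ->
  ord_ge (k.+1 - head 0%N mu) ((1 - x) ^+ n *
    (\sum_(la <- shapes k.+1 n | part la && subpart la mu) x ^+ ncols la mu) - 1).
Proof.
move=> x0; elim: n mu => [|n IHn] [|u mu] //; rewrite ?mem_shapes //.
  by move=> _ _; rewrite big_shapes0 expr0 mul1r subrr.
rewrite -mem_shapes shapes_consP part_cons => /andP[uk muK] /andP[hu pmu].
have smu : size mu = n by move: muK; rewrite mem_shapes => /andP[/eqP].
pose b la := maxn u (head 0%N la).
pose Q la := part la && subpart la mu.
have -> : \sum_(la <- shapes k.+1 n.+1 | part la && subpart la (u :: mu))
      x ^+ ncols la (u :: mu) =
  \sum_(la <- shapes k.+1 n | Q la) x ^+ ncols la mu *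
      \sum_(b la <= l < k.+1) x ^+ (l - b la).
  rewrite big_shapesS (exchange_big_dep Q) /=; last first.
    by move=> l la _; rewrite part_cons subpart_cons /Q =>
      /andP[/andP[_ ->] /and3P[_ _ ->]].
  apply: eq_bigr => la /andP[pla sub].
  rewrite (big_nat_widenl (b la) 0%N) // big_distrr /=; apply: eq_big => [l|l _].
    by rewrite part_cons subpart_cons pla sub hu geq_max /= !andbT andbC.
  by rewrite addnC exprD.
have geom la : la \in shapes k.+1 n ->
    (1 - x) * \sum_(b la <= l < k.+1) x ^+ (l - b la) = 1 - x ^+ (k.+1 - b la).
  move=> laK; rewrite -{1}[b la]add0n big_addn.
  under eq_bigr do rewrite addnK.
  by rewrite big_mkord -opprB mulNr -subrX1 opprB.
(* The full geometric series gives the main term, and its truncation at [k] the subtracted error. *)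
have -> : (1 - x) ^+ n.+1 * (\sum_(la <- shapes k.+1 n | Q la) x ^+ ncols la mu *
     \sum_(b la <= l < k.+1) x ^+ (l - b la)) - 1 =
  ((1 - x) ^+ n * (\sum_(la <- shapes k.+1 n | Q la) x ^+ ncols la mu) - 1)
  - (1 - x) ^+ n * \sum_(la <- shapes k.+1 n | Q la)
      x ^+ (ncols la mu + (k.+1 - b la)).
  rewrite addrAC -mulrBr -sumrB exprSr -mulrA big_distrr /=; congr (_ * _ - 1).
  rewrite big_seq_cond [RHS]big_seq_cond; apply: eq_bigr => la /andP[laK _].
  by rewrite mulrCA geom // mulrBr mulr1 exprD.
apply: ord_geB; first by apply: (ord_ge_le _ (IHn mu muK pmu)); rewrite /=; lia.
apply: ord_geMl; apply: ord_ge_sum => la laK /andP[pla sub].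
apply: (@ord_ge_le _ (ncols la mu + (k.+1 - b la))); last exact: ord_ge_exp.
have sla : size la = n by move: laK; rewrite mem_shapes => /andP[/eqP].
have hla : (head 0 la < k.+1)%N by rewrite ltnS -nth0; apply: nth_shapes laK.
have := @ncols_head la mu; rewrite sla smu => /(_ erefl pmu) /=; rewrite /b.
by move: (ncols _ _) => c; lia.
Qed.

(** Summing first over the largest shape cancels one factor up to the error of [sum_above], of order
    [k.+1 - mu_1]; the rest of the chain has order at least [mu_1], so the total error has order
    [k.+1]. *)
Lemma sum_chainsum k n (xs : seq (fps R)) : {in xs, forall x, fcoef x 0 = 0} ->
  ord_ge k.+1 (\prod_(x <- xs) (1 - x) ^+ n *
    (\sum_(la <- shapes k.+1 n | part la) chainsum k subpart n xs la) - 1).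
Proof.
elim: xs => [|x xs IH] xs0 /=.
  rewrite big_nil mul1r; under eq_bigr do rewrite -[_%:R]mul1r.
  by rewrite sum_shapes_delta ?part_nseq // subrr.
have x0 : fcoef x 0 = 0 by apply: xs0; rewrite inE eqxx.
have {}xs0 : {in xs, forall x, fcoef x 0 = 0}.
  by move=> y yxs; apply: xs0; rewrite inE yxs orbT.
rewrite big_cons /stepop (exchange_big_dep part) /=; last by move=> ? ? _ /andP[].
set P := \prod_(_ <- _) _; pose A := chainsum k subpart n xs.
pose E mu := (1 - x) ^+ n * (\sum_(la <- shapes k.+1 n | part la && subpart la mu)
  x ^+ ncols la mu) - 1.
have -> : (1 - x) ^+ n * P * (\sum_(mu <- shapes k.+1 n | part mu)
     \sum_(la <- shapes k.+1 n | part la && subpart la mu)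
       x ^+ ncols la mu * A mu) - 1 =
  (P * (\sum_(mu <- shapes k.+1 n | part mu) A mu) - 1)
   - P * (\sum_(mu <- shapes k.+1 n | part mu) - (A mu * E mu)).
  rewrite addrAC -mulrBr -sumrB; congr (_ - 1); rewrite mulrAC [X in _ = X]mulrC;
    congr (_ * _).
  rewrite big_distrr /=; apply: eq_bigr => mu _.
  rewrite opprK -big_distrl /= /E mulrBr mulr1 addrCA subrr addr0.
  by rewrite mulrA mulrC.
apply: ord_geB; first exact: IH.
apply: ord_geMl; apply: ord_ge_sum => mu muK pmu; rewrite -sub0r.
apply: ord_geB => //.
have hmu : (head 0 mu <= k)%N by rewrite -nth0; apply: nth_shapes muK.
rewrite -(subnKC (leqW hmu)); apply: ord_geM; first exact: chainsum_ord_ge.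
exact: sum_above.
Qed.

End Order.

(** Every nonzero column has a descent and thus adds at least 1 to the corner volume. *)
Lemma PPinf_volume d n m pi : PPinf n m pi -> (corner_volume pi <= d)%N ->
  PP d n m pi.
Proof.
move=> PPpi vol_d; have [pp_pi rows le_m] := PPpi;
  have [/finite_seqP[s supp_s] dr dc] := pp_pi.
(* This provisional bound on the columns, from the finite support, makes the corner volume an
   explicit finite sum. *)
pose k := (\max_(c <- s) c.2).+1.
have bpi : boxed_pp k n m pi.
  split=> // i j; first exact: PPinf_row0 PPpi.
  apply: contraTeq; rewrite -lt0n -ltnNge ltnS => pi_gt0.
  apply: (@leq_bigmax_seq _ _ xpredT (fun c : nat * nat => c.2) (i, j)) => //.
  by have : Defs.support pi (i, j) by []; rewrite supp_s.
split=> //; apply: subset_card_le => j [i pi_gt0] /=.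
have pos j' : (j' <= j)%N -> (0 < pi 0%N j')%N.
  by move=> le_j; apply: leq_trans pi_gt0 _; apply: plane_partition_le.
apply: leq_trans vol_d; rewrite (corner_volumeE bpi) exchange_big /=.
have jk : (j < k)%N.
  by rewrite ltnNge; apply: contraL pi_gt0 => kj; have [_ -> //] := bpi.
apply: (@leq_trans (\sum_(0 <= j' < j.+1) 1)%N).
  by rewrite sum_nat_const_nat subn0 muln1.
rewrite (big_cat_nat (leq0n j.+1) jk) /=; apply: leq_trans (leq_addr _ _).
rewrite big_nat_cond [leqRHS]big_nat_cond; apply: leq_sum => j';
  rewrite andbT /= ltnS => le_j.
apply: leq_trans (pos _ le_j) _.
(* Going down a column, the entry changes only at descents, where the old entry is added in full. *)
have telescope t : (pi 0%N j' <= \sum_(0 <= i < t)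
    (if pi i.+1 j' < pi i j' then pi i j' else 0) + pi t j')%N.
  elim: t => [|t IHt]; first by rewrite big_geq.
  rewrite big_nat_recr //= -addnA; apply: leq_trans IHt _; rewrite leq_add2l.
  by case: ltnP => // _; apply: leq_addr.
by apply: leq_trans (telescope n) _; have [-> // _ _ _ _] := bpi; rewrite addn0.
Qed.

(** In degree [d] only plane partitions with at most [d] nonzero columns contribute, so a congruence
    modulo degree [d + 1] for [PP d n m] suffices. *)
Lemma sum_PPinf n m :
  fps_has_sum (PPinf n m) (fun pi => fpsX int ^+ corner_volume pi)
    (\prod_(1 <= i < m.+1) (1 - fpsX int ^+ i) ^- n).
Proof.
move=> d; set G := \prod_(_ <= _ < _) _;
  pose F (pi : array) := fpsX int ^+ corner_volume pi.
have small pi : PPinf n m pi -> fcoef (F pi) d <> 0 -> PP d n m pi.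
  move=> PPpi; rewrite /F fcoefXn; case: eqVneq => // dE _.
  by apply: PPinf_volume => //; rewrite -dE.
split.
  by apply: sub_finite_set (finite_PP d n m) => pi [PPpi /(small _ PPpi)].
transitivity (\sum_(pi \in PP d n m) fcoef (F pi) d).
  apply/esym/fsbig_widen => [pi []//|pi [PPpi nPP] /=].
  by apply: contrapT => /(small _ PPpi).
have -> : \sum_(pi \in PP d n m) fcoef (F pi) d =
  fcoef (\sum_(pi \in PP d n m) F pi) d.
  by rewrite !sum_PP -big_filter -[in RHS]big_filter fcoef_sum.
rewrite sum_PP_qpow /= /stepop; set xs := qpows _ m.
have xs0 : {in xs, forall x, fcoef x 0 = 0}.
  by move=> _ /mapP[i _ ->]; rewrite fcoefXn.
(* The first operator C(1) on the rectangle sums over all partitions in the box. *)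
have -> : \sum_(mu <- shapes d.+1 n | subpart (nseq n d) mu)
    1 ^+ ncols (nseq n d) mu * chainsum d subpart n xs mu =
  \sum_(mu <- shapes d.+1 n | part mu) chainsum d subpart n xs mu.
  rewrite big_seq_cond [RHS]big_seq_cond; apply: eq_big => [mu|mu _].
    have [muK|//] := boolP (mu \in _); rewrite /subpart /= andbC.
    have -> // : leqs mu (nseq n d); apply/leqs_nth => i; rewrite nth_nseq.
    case: ltnP => ni; first exact: nth_shapes muK.
    by rewrite nth_default //; move: muK; rewrite mem_shapes => /andP[/eqP->].
  by rewrite expr1n mul1r.
set S := \sum_(_ <- _ | _) _; have := @sum_chainsum _ d n _ xs0; rewrite -/S.
set P := \prod_(_ <- _) _ => PS1.
have GP : G * P = 1.
  rewrite /P /xs /qpows big_map /G big_add1 /= /index_iota subn0 -big_split /=.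
  apply: big1 => i _; rewrite mulVr // unitrX // fps_unitE fcoefD fcoefN.
  by rewrite fcoef1 fcoefXn subr0 unitr1.
have : ord_ge d.+1 (S - G).
  (* As [G * P = 1], the difference [S - G] equals [G * (P * S - 1)]. *)
  by rewrite -[S]mul1r -GP -mulrA -[X in _ - X]mulr1 -mulrBr; apply: ord_geMl.
by move=> /(_ d (ltnSn d)); rewrite fcoefD fcoefN => /subr0_eq.
Qed.

Theorem theorem6p8 (k n m : nat)
    (k_ge1 : (1 <= k)%N) (n_ge1 : (1 <= n)%N) (m_ge1 : (1 <= m)%N) :
  let rho := nseq n k in
  [/\ \sum_(pi \in PP k n m) ('X^(corner_volume pi) : {poly int})
        = (schur {poly int} (n + m) rho).@[@ones_qpowers n m],
      \sum_(pi \in PP' k n m) ('X^(corner_volume pi) : {poly int})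
        = (schur {poly int} (n - 1 + m) rho).@[@ones_qpowers (n - 1) m]
    & fps_has_sum (PPinf n m)
        (fun pi => fpsX int ^+ corner_volume pi)
        (\prod_(1 <= i < m.+1) (1 - fpsX int ^+ i) ^- n)].
Proof.
move=> rho; split; last exact: sum_PPinf.
  rewrite schur_rect ?addn_gt0 ?n_ge1 // ones_qpowersE sum_PP_qpow chainsum_rect //.
  (* The [n - 1] ones produced by E join the one of the additional factor C(1). *)
  by rewrite -[1 :: qpows _ _]/(nseq 1 1 ++ _) catA -nseqD addn1 prednK.
rewrite schur_rect ?addn_gt0 ?m_ge1 ?orbT // ones_qpowersE sum_PP'_qpow //.
by rewrite chainsum_rect // subn1.
Qed.
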